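(* Suppose $\delta\colon\Gamma(L^{\mathbb{C}})\to\Gamma(L^{\mathbb{C}}\boxtimes L^{\mathbb{C}})$ is any linear map that is equivariant with respect to the action of $\mathrm{G}_2^{\mathbb{C}}$. Then, identifying $\Gamma(L^{\mathbb{C}})$ with the imaginary bioctonions $\mathbb{I}^{\mathbb{C}}$, the adjoint $\delta^*\colon\mathbb{I}^{\mathbb{C}}\otimes\mathbb{I}^{\mathbb{C}}\to\mathbb{I}^{\mathbb{C}}$ is the cross product up to a nonzero constant factor.
   Context: $\mathbb{H}$ denotes the quaternions. The split octonions $\mathbb{O}'$ are $\mathbb{H}\oplus\mathbb{H}$ with product $(a,b)(c,d)=(ac+d\overline{b},\,\overline{a}d+cb)$ and quadratic form $Q(a,b)=|a|^2-|b|^2$; $\mathbb{I}=\mathrm{Im}(\mathbb{H})\oplus\mathbb{H}$. The bioctonions are $\mathbb{O}^{\mathbb{C}}=\mathbb{C}\otimes\mathbb{O}'$, and the imaginary bioctonions are $\mathbb{I}^{\mathbb{C}}=\mathbb{C}\otimes\mathbb{I}$; $Q$ and the product are extended to the complexification, the dot product is the symmetric complex bilinear form with $x\cdot x=Q(x)$, and the cross product is $x\times y=\tfrac12(xy-yx)$ for $x,y\in\mathbb{I}^{\mathbb{C}}$. $\mathrm{G}_2^{\mathbb{C}}$ is the complex form of $\mathrm{G}_2$, i.e. the group of complex linear transformations of $\mathbb{I}^{\mathbb{C}}$ preserving the cross product. $C^{\mathbb{C}}=\{x\in\mathbb{I}^{\mathbb{C}}:Q(x)=0\}$ and $\mathrm{P}C^{\mathbb{C}}=\{x\in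 C^{\mathbb{C}}:x\ne0\}/\mathbb{C}^*$. $L^{\mathbb{C}}\to\mathrm{P}C^{\mathbb{C}}$ is the holomorphic line bundle whose fiber $L_{\langle x\rangle}$ is the space of complex linear functionals on the line $\langle x\rangle$ spanned by $x$. $L^{\mathbb{C}}\boxtimes L^{\mathbb{C}}$ is the external tensor product over $\mathrm{P}C^{\mathbb{C}}\times\mathrm{P}C^{\mathbb{C}}$, with fiber $L_a\otimes L_b$ over $(a,b)$. $\Gamma$ denotes the space of global holomorphic sections. $\mathrm{G}_2^{\mathbb{C}}$ acts naturally on all of these. Identifications: $\mathbb{I}^{\mathbb{C}}\cong\Gamma(L^{\mathbb{C}})$ via $w\mapsto s_w$, where $s_w$ at $\langle x\rangle$ is the functional $x\mapsto w\cdot x$; $\Gamma(L^{\mathbb{C}}\boxtimes L^{\mathbb{C}})\cong\Gamma(L^{\mathbb{C}})\otimes\Gamma(L^{\mathbb{C}})\cong\mathbb{I}^{\mathbb{C}}\otimes\mathbb{I}^{\mathbb{C}}$. So $\delta$ becomes a linear map $\mathbb{I}^{\mathbb{C}}\to\mathbb{I}^{\mathbb{C}}\otimes\mathbb{I}^{\mathbb{C}}$, and $\delta^*$ is its adjoint (dual map), with $\mathbb{I}^{\mathbb{C}}$ identified with its dual using the dot product.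
   Formalization: The linear map δ is additionally assumed to be nonzero: δ = 0 is linear and equivariant, but its adjoint is 0, which is not the cross product times a nonzero constant. *)

(* Defs.v *)
(* The complex numbers are R[i], for R : realType. *)
From HB Require Import structures.
From mathcomp Require Import all_boot all_order all_algebra ring complex.
From mathcomp Require Import all_classical all_reals all_analysis.

Set Implicit Arguments.
Unset Strict Implicit.
Unset Printing Implicit Defensive.

Import Order.TTheory GRing.Theory Num.Theory.
Import numFieldNormedType.Exports.
Local Open Scope classical_set_scope.
Local Open Scope ring_scope.

(* All formulas below have integer (or half-integer) structure constants, so    *)
(* over a field K they describe K (x)_R H, K (x)_R O' and K (x)_R I; K = R      *)
(* gives the split octonions themselves, K = R[i] the bioctonions.              *)
(* A quaternion is the row of its coordinates in the basis 1, i, j, k; an       *)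
(* element of Im H (+) H is the row of its 3 + 4 coordinates.                   *)
Notation quat K := 'rV[K]_(1 + 3).
Notation oct K := (quat K * quat K)%type.
Notation imoct K := 'rV[K]_(3 + 4).

Section Bioctonions.
Variable K : numFieldType.
Implicit Types (a b : quat K) (p q : oct K) (x y z w : imoct K).

Definition qmul a b : quat K := \row_i
  [:: a 0 0 * b 0 0 - a 0 1 * b 0 1 - a 0 2 * b 0 2 - a 0 3 * b 0 3;
      a 0 0 * b 0 1 + a 0 1 * b 0 0 + a 0 2 * b 0 3 - a 0 3 * b 0 2;
      a 0 0 * b 0 2 - a 0 1 * b 0 3 + a 0 2 * b 0 0 + a 0 3 * b 0 1;
      a 0 0 * b 0 3 + a 0 1 * b 0 2 - a 0 2 * b 0 1 + a 0 3 * b 0 0]`_i.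

(* K-linear: over R[i] this is not composed with complex conjugation. *)
Definition qconj a : quat K := row_mx (lsubmx a) (- rsubmx a).

Definition qnorm2 a : K := \sum_i a 0 i ^+ 2.

Definition omul p q : oct K :=
  (qmul p.1 q.1 + qmul q.2 (qconj p.2), qmul (qconj p.1) q.2 + qmul q.1 p.2).

Definition oquad p : K := qnorm2 p.1 - qnorm2 p.2.

(* The inclusion of Im H (+) H in H (+) H, and the projection that forgets the  *)
(* real part of the first quaternion.                                           *)
Definition im_oct x : oct K := (row_mx 0 (lsubmx x), rsubmx x).

Definition oct_im p : imoct K := row_mx (rsubmx p.1) p.2.

Definition quad x : K := oquad (im_oct x).

(* Polarization: the symmetric bilinear form with dot x x = quad x (dotxx). *)
Definition dot x y : K := 2^-1 * (quad (x + y) - quad x - quad y).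

(* The real part dropped by oct_im is zero here: see im_oct_cross. *)
Definition cross x y : imoct K :=
  oct_im (2^-1 *: (omul (im_oct x) (im_oct y) - omul (im_oct y) (im_oct x))).

Lemma im_octE x : im_oct x =
  (\row_(i < 4) [:: 0; x 0 0; x 0 1; x 0 2]`_i,
   \row_(i < 4) [:: x 0 3; x 0 4; x 0 5; x 0 6]`_i).
Proof.
congr pair; apply/rowP => i; rewrite !mxE.
- case: splitP => j; rewrite ?mxE => ij.
    by rewrite ij (ord1 j).
  rewrite ij; case: j {ij} => -[|[|[|//]]] Hj; rewrite /= ?mxE /=; congr (x _ _); exact: val_inj.
- case: i => -[|[|[|[|//]]]] Hi; rewrite /=; congr (x _ _); exact: val_inj.
Qed.

Lemma qconjE a : qconj a = \row_(i < 4) [:: a 0 0; - a 0 1; - a 0 2; - a 0 3]`_i.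
Proof.
apply/rowP => i; rewrite !mxE.
case: splitP => j; rewrite ?mxE => ij.
  by rewrite ij (ord1 j) /=; congr (a _ _); exact: val_inj.
by rewrite ij; case: j {ij} => -[|[|[|//]]] Hj; rewrite /= ?mxE /=; congr (- a _ _); exact: val_inj.
Qed.

Lemma qnorm2E a : qnorm2 a = a 0 0 ^+ 2 + a 0 1 ^+ 2 + a 0 2 ^+ 2 + a 0 3 ^+ 2.
Proof.
rewrite /qnorm2 !big_ord_recl big_ord0 addr0 !addrA.
by congr (a 0 _ ^+ 2 + a 0 _ ^+ 2 + a 0 _ ^+ 2 + a 0 _ ^+ 2); apply: val_inj.
Qed.

Lemma quadE x : quad x = x 0 0 ^+ 2 + x 0 1 ^+ 2 + x 0 2 ^+ 2
  - x 0 3 ^+ 2 - x 0 4 ^+ 2 - x 0 5 ^+ 2 - x 0 6 ^+ 2.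
Proof. rewrite /quad im_octE /oquad !qnorm2E /= !mxE /=. ring. Qed.

Lemma dotE x y : dot x y = x 0 0 * y 0 0 + x 0 1 * y 0 1 + x 0 2 * y 0 2
  - x 0 3 * y 0 3 - x 0 4 * y 0 4 - x 0 5 * y 0 5 - x 0 6 * y 0 6.
Proof. by rewrite /dot !quadE !mxE; field. Qed.

Lemma crossE x y : cross x y = \row_(i < 7)
  [:: x 0 1 * y 0 2 - x 0 2 * y 0 1
        - y 0 3 * x 0 4 + y 0 4 * x 0 3 - y 0 5 * x 0 6 + y 0 6 * x 0 5;
      x 0 2 * y 0 0 - x 0 0 * y 0 2
        - y 0 3 * x 0 5 + y 0 4 * x 0 6 + y 0 5 * x 0 3 - y 0 6 * x 0 4;
      x 0 0 * y 0 1 - x 0 1 * y 0 0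
        - y 0 3 * x 0 6 - y 0 4 * x 0 5 + y 0 5 * x 0 4 + y 0 6 * x 0 3;
      - y 0 0 * x 0 4 - y 0 1 * x 0 5 - y 0 2 * x 0 6
        + x 0 0 * y 0 4 + x 0 1 * y 0 5 + x 0 2 * y 0 6;
      y 0 0 * x 0 3 + y 0 1 * x 0 6 - y 0 2 * x 0 5
        - x 0 0 * y 0 3 - x 0 1 * y 0 6 + x 0 2 * y 0 5;
      - y 0 0 * x 0 6 + y 0 1 * x 0 3 + y 0 2 * x 0 4
        + x 0 0 * y 0 6 - x 0 1 * y 0 3 - x 0 2 * y 0 4;
      y 0 0 * x 0 5 - y 0 1 * x 0 4 + y 0 2 * x 0 3
        - x 0 0 * y 0 5 + x 0 1 * y 0 4 - x 0 2 * y 0 3]`_i.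
Proof.
apply/rowP => i; rewrite /cross /oct_im !im_octE /omul !qconjE /= [LHS]mxE [RHS]mxE.
case: splitP => j -> {i}; case: j.
- by case=> [|[|[|//]]] ?; do ![rewrite mxE /=]; field.
- by case=> [|[|[|[|//]]]] ?; do ![rewrite mxE /=]; field.
Qed.

Lemma im_oct_cross x y : im_oct (cross x y) =
  2^-1 *: (omul (im_oct x) (im_oct y) - omul (im_oct y) (im_oct x)).
Proof.
rewrite /cross; set p := 2^-1 *: _.
suff p0 : lsubmx p.1 = 0.
  by rewrite /im_oct /oct_im row_mxKl row_mxKr -p0 hsubmxK; case: (p).
apply/rowP => i; rewrite ord1 /p !im_octE /omul !qconjE /=.
rewrite mxE (_ : lshift 3 0 = 0); last exact: val_inj.
by do ![rewrite mxE /=]; ring.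
Qed.

Lemma cross_linear x : linear (cross x).
Proof.
move=> k y z; rewrite !crossE; apply/rowP.
by case=> [[|[|[|[|[|[|[|//]]]]]]] ?]; do ![rewrite mxE /=]; ring.
Qed.

Lemma cross_anti x y : cross x y = - cross y x.
Proof.
rewrite !crossE; apply/rowP.
by case=> [[|[|[|[|[|[|[|//]]]]]]] ?]; rewrite !mxE /=; ring.
Qed.

Lemma cross_cross x y : cross x (cross x y) = dot x y *: x - quad x *: y.
Proof.
rewrite dotE quadE [LHS]crossE; apply/rowP.
case=> [[|[|[|[|[|[|[|//]]]]]]] Hi]; rewrite mxE /= crossE; do ![rewrite mxE /=].
- have -> : Ordinal Hi = 0 by apply: val_inj. ring.
- have -> : Ordinal Hi = 1 by apply: val_inj. ring.
- have -> : Ordinal Hi = 2 by apply: val_inj. ring.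
- have -> : Ordinal Hi = 3 by apply: val_inj. ring.
- have -> : Ordinal Hi = 4 by apply: val_inj. ring.
- have -> : Ordinal Hi = 5 by apply: val_inj. ring.
- have -> : Ordinal Hi = 6 by apply: val_inj. ring.
Qed.

Lemma dot_linear x : scalar (dot x).
Proof. by move=> k y z; rewrite !dotE !mxE; ring. Qed.

HB.instance Definition _ x :=
  GRing.isLinear.Build K (imoct K) K^o *:%R (dot x) (@dot_linear x).

Lemma dotC x y : dot x y = dot y x.
Proof. by rewrite !dotE; ring. Qed.

Lemma dotxx x : dot x x = quad x.
Proof. by rewrite dotE quadE; ring. Qed.

HB.instance Definition _ x :=
  GRing.isLinear.Build K (imoct K) (imoct K) *:%R (cross x) (@cross_linear x).

End Bioctonions.

(* I (x) I, with x (x) y represented by the matrix of the x_i y_j. *)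
Notation imoct2 K := 'M[K]_(3 + 4).

Section Tensors.
Variable K : numFieldType.
Implicit Types (x y : imoct K) (T S : imoct2 K).

Local Notation e i := (delta_mx 0 i : imoct K).

Definition tens x y : imoct2 K := x^T *m y.

(* The bilinear form with (u (x) v)(x, y) = (u . x) (v . y). *)
Definition tens_eval T x y : K :=
  \sum_i \sum_j T i j * (dot (e i) x * dot (e j) y).

(* The form induced by dot: <u (x) v, x (x) y> = (u . x) (v . y). *)
Definition tens_dot T S : K := \sum_i \sum_j S i j * tens_eval T (e i) (e j).

(* The linear map I (x) I -> I induced by the cross product: tens_cross_tens. *)
Definition tens_cross T : imoct K := \sum_i \sum_j T i j *: cross (e i) (e j).

Lemma tens_evalDl T x : scalar (tens_eval T x).
Proof.
move=> k y z; rewrite /tens_eval mulr_sumr -big_split; apply: eq_bigr => i _.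
rewrite mulr_sumr -big_split; apply: eq_bigr => j _ /=.
rewrite dot_linear; ring.
Qed.

HB.instance Definition _ T x :=
  GRing.isLinear.Build K (imoct K) K^o *:%R (tens_eval T x) (@tens_evalDl T x).

Lemma tens_evalDr T y : scalar (tens_eval T ^~ y).
Proof.
move=> k x z; rewrite /tens_eval mulr_sumr -big_split; apply: eq_bigr => i _.
rewrite mulr_sumr -big_split; apply: eq_bigr => j _ /=.
rewrite dot_linear; ring.
Qed.

Lemma tens_cross_tens x y : tens_cross (tens x y) = cross x y.
Proof.
rewrite /tens_cross.
transitivity (\sum_i - (x 0 i *: cross y (e i))).
  apply: eq_bigr => i _; rewrite -scalerN -cross_anti.
  rewrite [in RHS](row_sum_delta y) linear_sum scaler_sumr.
  apply: eq_bigr => j _; rewrite linearZ /= scalerA; congr (_ *: _).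
  by rewrite !mxE big_ord1 !mxE.
rewrite cross_anti [in RHS](row_sum_delta x).
rewrite linear_sum -sumrN; apply: eq_bigr => i _; by rewrite [in RHS]linearZ.
Qed.

End Tensors.

Section AllSections.
Variables (K : pzRingType) (T : Type) (V : T -> lmodType K).

(* Set-theoretic sections of the bundle with fibers V t, as a module. *)
Definition all_sections := forall t, V t.

HB.instance Definition _ := gen_eqMixin all_sections.
HB.instance Definition _ := gen_choiceMixin all_sections.

Implicit Types s u : all_sections.
Let add s u : all_sections := fun t => s t + u t.
Let opp s : all_sections := fun t => - s t.
Let zero : all_sections := fun t => 0.
Let scale (k : K) s : all_sections := fun t => k *: s t.

Fact family_addA : associative add.
Proof. by move=> s u v; apply: functional_extensionality_dep => t; apply: addrA. Qed.
Fact family_addC : commutative add.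
Proof. by move=> s u; apply: functional_extensionality_dep => t; apply: addrC. Qed.
Fact family_add0 : left_id zero add.
Proof. by move=> s; apply: functional_extensionality_dep => t; apply: add0r. Qed.
Fact family_addN : left_inverse zero opp add.
Proof. by move=> s; apply: functional_extensionality_dep => t; apply: addNr. Qed.

HB.instance Definition _ := GRing.isZmodule.Build all_sections
  family_addA family_addC family_add0 family_addN.

Fact family_scaleA k l s : scale k (scale l s) = scale (k * l) s.
Proof. by apply: functional_extensionality_dep => t; apply: scalerA. Qed.
Fact family_scale1 : left_id 1 scale.
Proof. by move=> s; apply: functional_extensionality_dep => t; apply: scale1r. Qed.
Fact family_scaleDr : right_distributive scale +%R.
Proof. by move=> k s u; apply: functional_extensionality_dep => t; apply: scalerDr. Qed.
Fact family_scaleDl s : {morph scale^~ s : k l / k + l}.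
Proof. by move=> k l; apply: functional_extensionality_dep => t; apply: scalerDl. Qed.

HB.instance Definition _ := GRing.Zmodule_isLmodule.Build K all_sections
  family_scaleA family_scale1 family_scaleDr family_scaleDl.

End AllSections.

Section Holomorphy.
Variable K : numFieldType.

(* For an embedding j of a complex submanifold in V, this says that f is        *)
(* holomorphic: near each point it is the restriction of a complex              *)
(* differentiable function on an open subset of the ambient space.              *)
Definition holomorphic_along (V : normedModType K) (T : Type) (j : T -> V)
    (f : T -> K^o) : Prop :=
  forall t, exists F : V -> K^o, \forall v \near j t,
    differentiable F v /\ forall u, j u = v -> f u = F v.

Lemma holo_comb (V : normedModType K) (T : Type) (j : T -> V) k f h :
  holomorphic_along j f -> holomorphic_along j h ->
  holomorphic_along j (k *: f + h).
Proof.
move=> jf jh t; have [F Ff] := jf t; have [H Hh] := jh t.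
exists (k *: F + H); near=> v.
have [dF fF] : differentiable F v /\ forall u, j u = v -> f u = F v.
  by near: v.
have [dH hH] : differentiable H v /\ forall u, j u = v -> h u = H v.
  by near: v.
split; first by apply: differentiableD => //; exact: differentiableZ.
by move=> u juv; congr (k *: _ + _); [exact: fF | exact: hH].
Unshelve. all: by end_near. Qed.

Lemma holo_global (V : normedModType K) (T : Type) (j : T -> V)
    (f : T -> K^o) (F : V -> K^o) :
  (forall v, differentiable F v) -> (forall t, f t = F (j t)) ->
  holomorphic_along j f.
Proof.
by move=> dF fF t; exists F; near=> v; split=> // u <-.
Unshelve. all: by end_near. Qed.

Lemma holo_comp (V : normedModType K) (T : Type) (j : T -> V)
    (f : T -> K^o) (a : T -> T) (h : V -> V) :
  (forall v, differentiable h v) -> (forall t, j (a t) = h (j t)) ->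
  holomorphic_along j f -> holomorphic_along j (f \o a).
Proof.
move=> dh jh jf t; have [F Ff] := jf (a t).
exists (F \o h).
have ch : h @ nbhs (j t) --> h (j t) := differentiable_continuous (dh (j t)).
rewrite jh in Ff; have := ch _ Ff; rewrite /fmap /=; apply: (@filterS V (nbhs (j t)) (nbhs_filter _)) => v [dF fF]; split.
  exact: differentiable_comp.
by move=> u juv; rewrite /= fF // jh juv.
Qed.

Lemma fst_diff (V W : normedModType K) (x : V * W) :
  differentiable (fst : V * W -> V) x.
Proof. by apply: linear_differentiable => y; exact: cvg_fst. Qed.

Lemma snd_diff (V W : normedModType K) (x : V * W) :
  differentiable (snd : V * W -> W) x.
Proof. by apply: linear_differentiable => y; exact: cvg_snd. Qed.

Lemma linear_row_diff n (W : normedModType K) (f : {linear 'rV[K]_n -> W}) x :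
  differentiable f x.
Proof.
have -> : (f : _ -> _) = \sum_i (fun x : 'rV[K]_n => x 0 i *: f (delta_mx 0 i)).
  apply/funext => y; rewrite fct_sumE [in LHS](row_sum_delta y) linear_sum.
  by apply: eq_bigr => i _; rewrite linearZ.
apply: differentiable_sum => i.
exact/differentiableZl/differentiable_coord.
Qed.

Lemma tens_eval_diff (T : imoct2 K) xy :
  differentiable (fun v : imoct K * imoct K => tens_eval T v.1 v.2 : K^o) xy.
Proof.
pose d (i : 'I_(3 + 4)) : {linear imoct K -> K^o} := dot (delta_mx 0 i).
have -> : (fun v : imoct K * imoct K => tens_eval T v.1 v.2 : K^o) =
   \sum_i \sum_j (T i j *: ((d i \o fst) * (d j \o snd))).
  apply/funext => v; rewrite fct_sumE; apply: eq_bigr => i _.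
  by rewrite fct_sumE.
apply: differentiable_sum => i; apply: differentiable_sum => j.
apply: differentiableZ; apply: differentiableM.
  by apply: differentiable_comp; [exact: fst_diff | exact: linear_row_diff].
by apply: differentiable_comp; [exact: snd_diff | exact: linear_row_diff].
Qed.

Lemma pair_row_diff (f : {linear imoct K -> imoct K}) xy :
  differentiable (fun v : imoct K * imoct K => (f v.1, f v.2)) xy.
Proof.
apply: differentiable_pair.
  by apply: (@differentiable_comp _ _ _ _ fst f);
    [exact: fst_diff | exact: linear_row_diff].
by apply: (@differentiable_comp _ _ _ _ snd f);
  [exact: snd_diff | exact: linear_row_diff].
Qed.

End Holomorphy.

Section G2.
Variable R : realType.
Local Notation C := R[i].
Local Notation IC := (imoct C).

(* Invertibility is injectivity, the dimension being finite. *)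
Record G2C := MkG2C {
  G2_fun :> 'End(IC);
  G2_inj : lker G2_fun == 0%VS;
  G2_cross : forall x y, G2_fun (cross x y) = cross (G2_fun x) (G2_fun y) }.

Fact G2_injective (g : G2C) : injective g.
Proof. exact/lker0P/G2_inj. Qed.

Fact G2_inv_inj (g : G2C) : lker (g^-1)%VF == 0%VS.
Proof.
have gK := lker0_lfunK (G2_inj g); have gVK := lker0_lfunVK (G2_inj g).
by apply/lker0P => x y /(congr1 g); rewrite !gVK.
Qed.

Fact G2_inv_cross (g : G2C) x y :
  (g^-1)%VF (cross x y) = cross ((g^-1)%VF x) ((g^-1)%VF y).
Proof.
have gVK := lker0_lfunVK (G2_inj g).
by apply/(@G2_injective g); rewrite G2_cross !gVK.
Qed.

Definition G2_inv (g : G2C) : G2C := MkG2C (G2_inv_inj g) (@G2_inv_cross g).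

Lemma G2_quad (g : G2C) x : quad (g x) = quad x.
Proof.
have [->|x0] := eqVneq x 0; first by rewrite linear0.
have gx0 : g x != 0.
  apply: contra x0 => /eqP gx; apply/eqP/(@G2_injective g).
  by rewrite gx linear0.
apply/eqP; rewrite -subr_eq0; apply/negP => /negP Q0.
have dep y : exists k, y = k *: x.
  have := cross_cross (g x) (g y).
  rewrite -!G2_cross cross_cross linearB /= [g (_ *: x)]linearZ [g (_ *: y)]linearZ /= => E.
  move: (quad (g x)) (quad x) E Q0 => q1 q2 E Q0.
  exists ((q1 - q2)^-1 * (dot (g x) (g y) - dot x y)).
  apply: (@G2_injective g); rewrite linearZ /= -scalerA.
  rewrite -[LHS](scalerK Q0); congr (_ *: _).
  move/eqP: E; rewrite !scalerBl subr_eq => /eqP ->.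
  by rewrite !opprD opprK !addrA subrr add0r.
have [k0 E0] := dep (delta_mx 0 0); have [k1 E1] := dep (delta_mx 0 1).
have: k1 *: (delta_mx 0 0 : IC) == k0 *: delta_mx 0 1.
  by rewrite E0 E1 !scalerA mulrC.
move=> /eqP/rowP/(_ 1); rewrite !mxE /= mulr0 mulr1 => k00.
move: E0; rewrite -k00 scale0r => /rowP/(_ 0); rewrite !mxE /= => /eqP.
by rewrite oner_eq0.
Qed.

(* The points of the quotient of the nonzero null vectors by C^*, as lines. *)
Record PC := MkPC {
  PC_line :> {vspace IC};
  PC_dim : \dim PC_line = 1%N;
  PC_null : forall x, x \in PC_line -> quad x = 0 }.

Lemma PC_eq (p q : PC) : p = q :> {vspace IC} -> p = q.
Proof.
case: p q => [p p1 p0] [q q1 q0] /= pq; move: p1 p0; rewrite pq => p1 p0.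
by congr MkPC; exact: Prop_irrelevance.
Qed.

(* Nonzero null vectors. *)
Record cone := MkCone {
  cone_val :> IC;
  cone_neq0 : cone_val != 0;
  cone_null : quad cone_val = 0 }.

Lemma cone_eq (x y : cone) : x = y :> IC -> x = y.
Proof.
case: x y => [x x1 x0] [y y1 y0] /= xy; move: x1 x0; rewrite xy => x1 x0.
by congr MkCone; exact: Prop_irrelevance.
Qed.

Lemma quadZ k (x : IC) : quad (k *: x) = k ^+ 2 * quad x.
Proof. by rewrite !quadE !mxE; ring. Qed.

Fact span_cone_dim (x : cone) : \dim <[cone_val x]>%VS = 1%N.
Proof. by rewrite dim_vline cone_neq0. Qed.
Fact span_cone_null (x : cone) y : y \in <[cone_val x]>%VS -> quad y = 0.
Proof. by move=> /vlineP[k ->]; rewrite quadZ cone_null mulr0. Qed.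

Definition span_cone (x : cone) : PC :=
  MkPC (span_cone_dim x) (@span_cone_null x).

Fact G2_cone_neq0 (g : G2C) (x : cone) : g x != 0.
Proof.
apply: contra (cone_neq0 x) => /eqP gx; apply/eqP/(@G2_injective g).
by rewrite gx linear0.
Qed.
Fact G2_cone_null (g : G2C) (x : cone) : quad (g x) = 0.
Proof. by rewrite G2_quad cone_null. Qed.
Definition G2_cone (g : G2C) (x : cone) : cone :=
  MkCone (G2_cone_neq0 g x) (G2_cone_null g x).

Fact G2_PC_dim (g : G2C) (p : PC) : \dim (g @: p) = 1%N.
Proof.
by rewrite limg_dim_eq ?PC_dim // (eqP (G2_inj g)) capv0.
Qed.
Fact G2_PC_null (g : G2C) (p : PC) y : y \in (g @: p)%VS -> quad y = 0.
Proof. by move=> /memv_imgP[x px ->]; rewrite G2_quad; exact: PC_null px. Qed.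
Definition G2_PC (g : G2C) (p : PC) : PC :=
  MkPC (G2_PC_dim g p) (@G2_PC_null g p).

Lemma G2_span_cone g x : G2_PC g (span_cone x) = span_cone (G2_cone g x).
Proof. by apply: PC_eq; rewrite /= limg_line. Qed.

Definition line_map (g : G2C) (p : PC) : 'Hom(subvs_of p, subvs_of (G2_PC g p)) :=
  (linfun (vsproj (G2_PC g p)) \o g \o linfun (@vsval _ _ p))%VF.

Lemma line_mapE g p u : vsval (line_map g p u) = g (vsval u).
Proof.
rewrite /line_map !comp_lfunE !lfunE /= vsprojK //.
exact: memv_img (subvsP u).
Qed.

Definition L_fiber (p : PC) : vectType C := 'Hom(subvs_of p, C^o).

(* The tensor product of the duals of the lines a and b, as Hom(a, Hom(b, C)): *)
(* the bilinear forms on a x b.                                              *)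
Definition LL_fiber (ab : PC * PC) : vectType C :=
  'Hom(subvs_of ab.1, 'Hom(subvs_of ab.2, C^o)).

(* The function x |-> s_<x>(x) on the nonzero null vectors. The section s is    *)
(* holomorphic iff this function is: if sigma is a local holomorphic section of *)
(* the C^*-bundle cone -> PC, then s in the trivialization of L dual to sigma   *)
(* is L_total s \o sigma, and L_total s (c sigma(p)) = c L_total s (sigma(p)).  *)
Definition L_total (s : all_sections L_fiber) (x : cone) : C^o :=
  s (span_cone x) (vsproj (span_cone x) x).

Definition LL_total (s : all_sections LL_fiber) (xy : cone * cone) : C^o :=
  s (span_cone xy.1, span_cone xy.2)
    (vsproj (span_cone xy.1) xy.1) (vsproj (span_cone xy.2) xy.2).

Definition cone_val2 (xy : cone * cone) : IC * IC :=
  (cone_val xy.1, cone_val xy.2).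

Definition L_holomorphic : {pred all_sections L_fiber} :=
  fun s => `[< holomorphic_along cone_val (L_total s) >].

Definition LL_holomorphic : {pred all_sections LL_fiber} :=
  fun s => `[< holomorphic_along cone_val2 (LL_total s) >].

Fact L_submod : submod_closed L_holomorphic.
Proof.
split=> [|k s u /asboolP hs /asboolP hu]; apply/asboolP.
  apply: (holo_global (F := cst 0)) => [v|t]; first exact: differentiable_cst.
  by rewrite /L_total lfunE.
have -> : L_total (k *: s + u) = k *: L_total s + L_total u.
  by apply/funext => x; rewrite /L_total add_lfunE scale_lfunE.
exact: holo_comb.
Qed.

Fact LL_submod : submod_closed LL_holomorphic.
Proof.
split=> [|k s u /asboolP hs /asboolP hu]; apply/asboolP.
  apply: (holo_global (F := cst 0)) => [v|t]; first exact: differentiable_cst.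
  by rewrite /LL_total !lfunE.
have -> : LL_total (k *: s + u) = k *: LL_total s + LL_total u.
  by apply/funext => x; rewrite /LL_total !(add_lfunE, scale_lfunE).
exact: holo_comb.
Qed.

HB.instance Definition _ := GRing.isSubmodClosed.Build C (all_sections L_fiber)
  L_holomorphic L_submod.
HB.instance Definition _ := GRing.isSubmodClosed.Build C (all_sections LL_fiber)
  LL_holomorphic LL_submod.

Record Gamma_L := MkGamma_L {
  Gamma_L_val :> all_sections L_fiber; Gamma_L_holo : Gamma_L_val \in L_holomorphic }.
HB.instance Definition _ := [isSub for Gamma_L_val].
HB.instance Definition _ := [Choice of Gamma_L by <:].
HB.instance Definition _ := [SubChoice_isSubLmodule of Gamma_L by <:].

Record Gamma_LL := MkGamma_LL {
  Gamma_LL_val :> all_sections LL_fiber; Gamma_LL_holo : Gamma_LL_val \in LL_holomorphic }.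
HB.instance Definition _ := [isSub for Gamma_LL_val].
HB.instance Definition _ := [Choice of Gamma_LL by <:].
HB.instance Definition _ := [SubChoice_isSubLmodule of Gamma_LL by <:].


Definition L_pull (g : G2C) (s : all_sections L_fiber) : all_sections L_fiber :=
  fun p => (s (G2_PC g p) \o line_map g p)%VF.

Definition line_comap (g : G2C) (p : PC) :
    'Hom('Hom(subvs_of (G2_PC g p), C^o), 'Hom(subvs_of p, C^o)) :=
  linfun (fun phi => (phi \o line_map g p)%VF).

Lemma line_comapE g p phi u : line_comap g p phi u = phi (line_map g p u).
Proof.
pose f (psi : 'Hom(subvs_of (G2_PC g p), C^o)) := (psi \o line_map g p)%VF.
have linf : linear f.
  move=> k a b; apply/lfunP => z.
  by rewrite /f !(comp_lfunE, add_lfunE, scale_lfunE).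
pose lf : {linear _ -> _} := HB.pack f (GRing.isLinear.Build _ _ _ _ f linf).
by rewrite /line_comap (lfunE lf) /= /f comp_lfunE.
Qed.

Definition LL_pull (g : G2C) (s : all_sections LL_fiber) : all_sections LL_fiber :=
  fun ab => (line_comap g ab.2 \o s (G2_PC g ab.1, G2_PC g ab.2)
             \o line_map g ab.1)%VF.

Lemma line_map_span (g : G2C) (x : cone) :
  line_map g (span_cone x) (vsproj (span_cone x) x) =
  vsproj (G2_PC g (span_cone x)) (g x).
Proof.
apply: subvs_inj; rewrite line_mapE vsprojK ?memv_line // vsprojK //.
exact/memv_img/memv_line.
Qed.

Lemma L_total_pull g s x : L_total (L_pull g s) x = L_total s (G2_cone g x).
Proof.
rewrite /L_total /L_pull comp_lfunE line_map_span.
by rewrite G2_span_cone.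
Qed.

Lemma LL_total_pull g s xy :
  LL_total (LL_pull g s) xy = LL_total s (G2_cone g xy.1, G2_cone g xy.2).
Proof.
case: xy => x y; rewrite /LL_total /LL_pull comp_lfunE comp_lfunE.
apply: (etrans (line_comapE _ _)); rewrite [(x, y).1]/= [(x, y).2]/=.
have := line_map_span g x; have := line_map_span g y.
move: (line_map g (span_cone x) _) (line_map g (span_cone y) _) => _ _ -> ->.
by rewrite !G2_span_cone.
Qed.

Fact L_act_holo (g : G2C) (s : Gamma_L) :
  L_pull (G2_inv g) s \in L_holomorphic.
Proof.
have /asboolP hs := Gamma_L_holo s; apply/asboolP.
have -> : L_total (L_pull (G2_inv g) s) = L_total s \o G2_cone (G2_inv g).
  by apply/funext => x; rewrite L_total_pull.
by apply: (holo_comp (h := G2_inv g)) hs => // v; exact: linear_row_diff.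
Qed.

Fact LL_act_holo (g : G2C) (s : Gamma_LL) :
  LL_pull (G2_inv g) s \in LL_holomorphic.
Proof.
have /asboolP hs := Gamma_LL_holo s; apply/asboolP.
have -> : LL_total (LL_pull (G2_inv g) s) =
    LL_total s \o (fun xy => (G2_cone (G2_inv g) xy.1, G2_cone (G2_inv g) xy.2)).
  by apply/funext => x; rewrite LL_total_pull.
apply: (holo_comp (h := fun v => (G2_inv g v.1, G2_inv g v.2))) hs => // v.
exact: pair_row_diff.
Qed.

(* (g s)_p = s_(g^-1 p) o g^-1. *)
Definition L_act (g : G2C) (s : Gamma_L) : Gamma_L :=
  MkGamma_L (L_act_holo g s).

Definition LL_act (g : G2C) (s : Gamma_LL) : Gamma_LL :=
  MkGamma_LL (LL_act_holo g s).

Definition L_family (w : IC) : all_sections L_fiber :=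
  fun p => linfun (fun v : subvs_of p => dot w (vsval v) : C^o).

Definition LL_family (T : imoct2 C) : all_sections LL_fiber :=
  fun ab => linfun (fun u : subvs_of ab.1 =>
    linfun (fun v : subvs_of ab.2 => tens_eval T (vsval u) (vsval v) : C^o)).

Lemma L_total_family w x : L_total (L_family w) x = dot w x.
Proof.
rewrite /L_total /L_family.
rewrite (lfunE ((dot w : {linear _ -> C^o}) \o vsval)%FUN) /=.
by rewrite vsprojK ?memv_line.
Qed.

Lemma LL_total_family T xy :
  LL_total (LL_family T) xy = tens_eval T xy.1 xy.2.
Proof.
rewrite /LL_total /LL_family.
set f := fun u => linfun _.
have fE u v : f u v = tens_eval T (vsval u) (vsval v).
  by rewrite /f (lfunE ((tens_eval T (vsval u) : {linear _ -> C^o}) \o vsval)%FUN).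
have linf : linear f.
  move=> k u v; apply/lfunP => z.
  by rewrite add_lfunE scale_lfunE !fE linearP tens_evalDr.
pose lf : {linear _ -> _} := HB.pack f (GRing.isLinear.Build _ _ _ _ f linf).
rewrite (lfunE lf) /= fE.
by rewrite !vsprojK ?memv_line.
Qed.

Fact L_family_holo w : L_family w \in L_holomorphic.
Proof.
apply/asboolP; apply: (holo_global (F := dot w)) => [v|x].
  exact: linear_row_diff.
exact: L_total_family.
Qed.

Fact LL_family_holo T : LL_family T \in LL_holomorphic.
Proof.
apply/asboolP.
apply: (holo_global (F := fun v : IC * IC => tens_eval T v.1 v.2)) => [v|xy].
  exact: tens_eval_diff.
exact: LL_total_family.
Qed.

(* w |-> s_w, with s_w at <x> the functional x |-> w . x. *)
Definition L_section (w : IC) : Gamma_L := MkGamma_L (L_family_holo w).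

(* The linear map with u (x) v |-> s_u (x) s_v. *)
Definition LL_section (T : imoct2 C) : Gamma_LL := MkGamma_LL (LL_family_holo T).

(* The inverse of the linear bijection LL_section; the default value 0 of xget  *)
(* is never used, but neither existence nor uniqueness is proved here.          *)
Definition LL_tensor (s : Gamma_LL) : imoct2 C :=
  xget 0 [set T | LL_section T = s].

(* The dual map, I being identified with its dual by dot and I (x) I by         *)
(* tens_dot; the vector v is unique since dot is nondegenerate.                 *)
Definition adjoint (D : IC -> imoct2 C) (T : imoct2 C) : IC :=
  xget 0 [set v | forall w, dot v w = tens_dot (D w) T].

(* delta as a map I -> I (x) I through the two identifications. *)
Definition delta_imoct (delta : Gamma_L -> Gamma_LL) (w : IC) : imoct2 C :=
  LL_tensor (delta (L_section w)).

End G2.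

(* Main.v *)
Require Import Defs.
From HB Require Import structures.
From mathcomp Require Import all_boot all_order all_algebra ring lra complex.
From mathcomp Require Import all_classical all_reals all_analysis.

(** Two facts carry the proof: the global sections are only the linear forms
    and the tensors, and up to a factor there is only one invariant tensor.

    A section of L is a function f on the cone of nonzero null vectors with
    f (k x) = k f x. If x and y are orthogonal null vectors, the plane that
    they span lies in the cone, and f restricts there to a holomorphic section
    of O(1) over a projective line: the entire functions g t = f (x + t y) and
    h t = f (y + t x) are related by g t = t h (1/t), so g grows at most
    linearly and Liouville's theorem makes it affine ([section_line_affine]).
    Hence f is additive on null triples x, y, x + y ([cone_additive]), and a
    function with this property is the restriction of a linear form
    ([null_additive_linear]). So every section of L is some s_w, and, applying
    this in each variable, every section of the external square is given by a
    tensor ([L_section_surj], [LL_section_surj]).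

    Liouville's theorem is needed for functions that are only known to be
    complex differentiable at each point, so it is derived from Goursat's
    quartering argument ([goursat]), applied to a difference quotient of g in
    the coordinate log (z - a) ([sublinear_entire_Re_derivative]).

    An equivariant delta thus amounts to a trilinear form B on I that is
    invariant under G2, namely B w x y = delta (s_w) (x, y). The standard basis
    e_0, ..., e_6 is permuted up to factors by elements of G2 that realize the
    symmetries of the Fano plane. Its sign changes kill B e_i e_j e_k unless
    {i, j, k} is a line, and its permutations are transitive on ordered lines.
    Therefore the invariant trilinear forms are the multiples of w . (x * y)
    ([G2_invariant_trilinear_form]), where * is the cross product, and the
    factor c with B w x y = c (w . (x * y)) is the constant of the theorem. It
    is nonzero, since c = 0 would make delta vanish on every s_w, that is, on
    all sections. *)

Set Implicit Arguments.
Unset Strict Implicit.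
Unset Printing Implicit Defensive.

Import Order.TTheory GRing.Theory Num.Theory.
Import numFieldNormedType.Exports.
Local Open Scope classical_set_scope.
Local Open Scope ring_scope.

(** * Goursat's theorem for closed differential forms *)
Section SegmentIntegral.
Variable R : realType.
Implicit Types (f g : R -> R) (a b c k : R).

Definition integral_segment f a b : R :=
  \int[@lebesgue_measure R]_(x in `[a, b]) f x.

Let integrable_segment f a b : continuous f ->
  (@lebesgue_measure R).-integrable `[a, b] (EFin \o f).
Proof.
move=> cf; apply: continuous_compact_integrable; first exact: segment_compact.
exact: continuous_subspaceT.
Qed.

Lemma integral_segmentB f g a b : continuous f -> continuous g ->
  integral_segment (fun x => f x - g x) a b =
  integral_segment f a b - integral_segment g a b.
Proof. by move=> cf cg; apply: RintegralB => //; exact: integrable_segment. Qed.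

Lemma integral_segment_split f a b c : continuous f -> a <= b -> b <= c ->
  integral_segment f a c = integral_segment f a b + integral_segment f b c.
Proof.
move=> cf ab bc; rewrite /integral_segment.
have := @Rintegral_itvB R f (BLeft a) (BRight c) b (integrable_segment a c cf).
rewrite !bnd_simp => /(_ ab bc) E.
rewrite -(Rintegral_itv_obnd_cbnd (r := b)); last first.
  apply: integrableS (integrable_segment b c cf) => //.
  by move=> x; rewrite /= !in_itv /= => /andP[/ltW -> ->].
by rewrite -E addrC subrK.
Qed.

Lemma integral_segment_near_cst f a b k e : continuous f -> a <= b ->
  (forall x, a <= x <= b -> `|f x - k| <= e) ->
  `|integral_segment f a b - k * (b - a)| <= e * (b - a).
Proof.
move=> cf ab fk.
have fb x : a <= x <= b -> - e + k <= f x <= e + k.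
  by move=> /fk; rewrite ler_norml; lra.
have cstE r : \int[@lebesgue_measure R]_(_ in `[a, b]) r = r * (b - a).
  rewrite Rintegral_cst //= lebesgue_measure_itv /= lte_fin.
  by case: ltrgtP ab => // -> _; rewrite subrr.
have cst_int r : (@lebesgue_measure R).-integrable `[a, b] (EFin \o cst r).
  exact/integrable_segment/cst_continuous.
rewrite ler_norml lerBrDr -mulNr -mulrDl; apply/andP; split.
  rewrite -cstE; apply: le_Rintegral (cst_int _) (integrable_segment a b cf) _ => //.
  by move=> x; rewrite /= in_itv /= => /fb/andP[].
rewrite lerBlDr -mulrDl.
rewrite -cstE; apply: le_Rintegral (integrable_segment a b cf) (cst_int _) _ => //.
by move=> x; rewrite /= in_itv /= => /fb/andP[].
Qed.

End SegmentIntegral.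

Section Goursat.
Variable R : realType.

(** The left ends x n increase and the right ends x n + S n decrease, so the
    supremum of the left ends lies in all the intervals. *)
Lemma nested_halving (x S : nat -> R) :
  (forall n, 0 <= S n) -> (forall n, S n.+1 = S n / 2) ->
  (forall n, x n <= x n.+1 <= x n + S n.+1) ->
  exists l, forall n, x n <= l <= x n + S n.
Proof.
move=> S0 SS xS.
have up n k : x n <= x (n + k)%N.
  elim: k => [|k IH]; first by rewrite addn0.
  by rewrite addnS (le_trans IH) //; case/andP: (xS (n + k)%N).
have down n k : x (n + k)%N + S (n + k)%N <= x n + S n.
  elim: k => [|k IH]; first by rewrite addn0.
  rewrite addnS; apply: le_trans IH; have := xS (n + k)%N; rewrite SS; lra.
have ub n m : x m <= x n + S n.
  have [nm|/ltnW mn] := leqP n m.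
    rewrite -(subnKC nm); apply: le_trans (down n (m - n)%N).
    by rewrite lerDl.
  by rewrite -(subnKC mn); apply: le_trans (up m (n - m)%N) _; rewrite lerDl.
exists (sup (range x)) => n; apply/andP; split.
  apply: ub_le_sup; last by exists n.
  by exists (x 0%N + S 0%N) => _ [m _ <-].
by apply: ge_sup; [exists (x n), n | move=> _ [m _ <-]].
Qed.

(** The form P dx + Q dy, with P and Q differentiable at each point, is closed:
    the coefficient p2 common to both expansions says that the y-derivative of
    P is the x-derivative of Q. *)
Definition closed_form (P Q : R -> R -> R) := forall x y,
  exists p1 p2 q2, forall e, 0 < e -> exists2 d, 0 < d &
    forall h k, `|h| <= d -> `|k| <= d ->
    `|P (x + h) (y + k) - P x y - (p1 * h + p2 * k)| <= e * (`|h| + `|k|) /\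
    `|Q (x + h) (y + k) - Q x y - (p2 * h + q2 * k)| <= e * (`|h| + `|k|).

Variables P Q : R -> R -> R.
Hypothesis PQ : closed_form P Q.

Lemma linear_bound_continuous (f : R -> R) :
  (forall x, exists p, exists2 d, 0 < d & forall h, `|h| <= d ->
     `|f (x + h) - f x - p * h| <= `|h|) -> continuous f.
Proof.
move=> ff x; have [p [d d0 fp]] := ff x.
apply/cvgrPdist_le => e e0; near=> z.
rewrite distrC; have zd : `|z - x| <= d.
  by rewrite distrC; near: z; apply: cvgr_dist_le.
have ze : (`|p| + 1) * `|z - x| <= e.
  rewrite mulrC -ler_pdivlMr ?ltr_wpDl // distrC.
  by near: z; apply: cvgr_dist_le => //; rewrite divr_gt0 // ltr_wpDl.
apply: le_trans ze; rewrite mulrDl mul1r -normrM.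
rewrite -[f z - f x](subrK (p * (z - x))) (le_trans (ler_normD _ _)) // addrC.
by rewrite lerD2l; have := fp _ zd; rewrite [x + _]addrC subrK.
Unshelve. all: by end_near. Qed.

Let contP y : continuous (P ^~ y).
Proof.
apply: linear_bound_continuous => x.
have [p1 [p2 [q2 /(_ 1 ltr01)[d d0 H]]]] := PQ x y.
exists p1, d => // h hd.
have [] := H h 0 hd; first by rewrite normr0 ltW.
by rewrite !addr0 normr0 !mulr0 !addr0 mul1r.
Qed.

Let contQ x : continuous (Q x).
Proof.
apply: linear_bound_continuous => y.
have [p1 [p2 [q2 /(_ 1 ltr01)[d d0 H]]]] := PQ x y.
exists q2, d => // k kd.
have [] := H 0 k _ kd; first by rewrite normr0 ltW.
by rewrite !addr0 normr0 !mulr0 !add0r mul1r.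
Qed.

(** Minus the circulation of P dx + Q dy around [x, x + s] x [y, y + t]. The
    integrals over opposite sides are merged, so that the values of P and Q at
    a nearby point cancel inside the integrands. *)
Let circ x y s t : R :=
  integral_segment (fun u => P u (y + t) - P u y) x (x + s)
  - integral_segment (fun v => Q (x + s) v - Q x v) y (y + t).

Let contBP y y' : continuous (fun u => P u y' - P u y).
Proof. by move=> u; exact: (cvgB (@contP y' u) (@contP y u)). Qed.

Let contBQ x x' : continuous (fun v => Q x' v - Q x v).
Proof. by move=> u; exact: (cvgB (@contQ x' u) (@contQ x u)). Qed.

Let circ_splitl x y s1 s2 t : 0 <= s1 -> 0 <= s2 -> 0 <= t ->
  circ x y (s1 + s2) t = circ x y s1 t + circ (x + s1) y s2 t.
Proof.
move=> s10 s20 t0; rewrite /circ.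
rewrite (@integral_segment_split _ _ x (x + s1)) ?lerDl ?lerD2l //; last by lra.
rewrite !integral_segmentB // !addrA; lra.
Qed.

Let circ_splitr x y s t1 t2 : 0 <= s -> 0 <= t1 -> 0 <= t2 ->
  circ x y s (t1 + t2) = circ x y s t1 + circ x (y + t1) s t2.
Proof.
move=> s0 t10 t20; rewrite /circ.
rewrite (@integral_segment_split _ _ y (y + t1) (y + _)) ?lerDl ?lerD2l //; last by lra.
rewrite !integral_segmentB // !addrA; lra.
Qed.

(** The circulations around the four quarters add up to the total, the inner
    sides cancelling; so one of them is at least a quarter of it. *)
Let circ_quarter x y s t m : 0 <= s -> 0 <= t -> m <= `|circ x y s t| ->
  exists x' y', [/\ x <= x' <= x + s / 2, y <= y' <= y + t / 2 &
    m / 4 <= `|circ x' y' (s / 2) (t / 2)|].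
Proof.
move=> s0 t0; have s20 : 0 <= s / 2 by lra.
have t20 : 0 <= t / 2 by lra.
rewrite {1}(splitr s) circ_splitl // {1 2}(splitr t) !circ_splitr // => M.
apply: contrapT => N.
have lt x' y' : x <= x' <= x + s / 2 -> y <= y' <= y + t / 2 ->
    `|circ x' y' (s / 2) (t / 2)| < m / 4.
  by move=> xx yy; rewrite ltNge; apply/negP => H; apply: N; exists x', y'.
have := lt x y; have := lt x (y + t / 2).
have := lt (x + s / 2) y; have := lt (x + s / 2) (y + t / 2).
rewrite !lexx !lerDl s20 t20 => /(_ isT isT) l1 /(_ isT isT) l2 /(_ isT isT) l3 /(_ isT isT) l4.
move: M; apply/negP; rewrite -ltNge.
apply: le_lt_trans (ler_normD _ _) _.
apply: le_lt_trans (lerD (ler_normD _ _) (ler_normD _ _)) _.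
lra.
Qed.

(** Near (x, y) the linear parts of P and Q contribute p2 * s * t to each of
    the two integrals, and these cancel because the form is closed. Only the
    error terms remain, which are small compared with the squared size. *)
Let circ_local x y e : 0 < e -> exists2 d, 0 < d & forall x' y' s t,
  0 <= s <= d -> 0 <= t <= d -> x' <= x <= x' + s -> y' <= y <= y' + t ->
  `|circ x' y' s t| <= 2 * e * (s + t) ^+ 2.
Proof.
move=> e0; have [p1 [p2 [q2 /(_ e e0)[d d0 H]]]] := PQ x y.
exists d => // x' y' s t /andP[s0 sd] /andP[t0 td] xx yy.
have est u v : x' <= u <= x' + s -> y' <= v <= y' + t ->
    `|P u v - P x y - (p1 * (u - x) + p2 * (v - y))| <= e * (s + t) /\
    `|Q u v - Q x y - (p2 * (u - x) + q2 * (v - y))| <= e * (s + t).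
  move=> uu vv.
  have us : `|u - x| <= s by rewrite ler_norml; lra.
  have vt : `|v - y| <= t by rewrite ler_norml; lra.
  have [] := H (u - x) (v - y) (le_trans us sd) (le_trans vt td).
  rewrite !(addrC _ (_ - _)) !subrK => H1 H2.
  have E : e * (`|u - x| + `|v - y|) <= e * (s + t).
    by rewrite ler_pM2l // lerD.
  by split; [exact: le_trans H1 E | exact: le_trans H2 E].
have IP : `|integral_segment (fun u => P u (y' + t) - P u y') x' (x' + s)
    - p2 * t * (x' + s - x')| <= 2 * (e * (s + t)) * (x' + s - x').
  apply: integral_segment_near_cst => //; first by rewrite lerDl.
  move=> u uu; have [] := est u (y' + t) uu; first by lra.
  have [] := est u y' uu; first by lra.
  by rewrite !ler_norml; lra.
have IQ : `|integral_segment (fun v => Q (x' + s) v - Q x' v) y' (y' + t)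
    - p2 * s * (y' + t - y')| <= 2 * (e * (s + t)) * (y' + t - y').
  apply: integral_segment_near_cst => //; first by rewrite lerDl.
  move=> v vv; have [] := est (x' + s) v _ vv; first by lra.
  have [] := est x' v _ vv; first by lra.
  by rewrite !ler_norml; lra.
rewrite /circ; move: IP IQ; rewrite !(addrC x') !(addrC y') !addrK !ler_norml.
set I := integral_segment _ _ _; set J := integral_segment _ _ _.
move=> /andP[I1 I2] /andP[J1 J2]; apply/andP; split; lra.
Qed.

(** If the circulation were nonzero, repeated quartering would give rectangles
    shrinking to a point, with a circulation of at least a fixed multiple of
    the squared size; this contradicts [circ_local] at that point. Quartering
    takes the place of continuity of the derivatives, which pointwise complex
    differentiability does not give beforehand. *)
Lemma goursat x1 x2 y1 y2 : x1 <= x2 -> y1 <= y2 ->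
  integral_segment (fun u => P u y2 - P u y1) x1 x2 =
  integral_segment (fun v => Q x2 v - Q x1 v) y1 y2.
Proof.
move=> x12 y12; apply/eqP; rewrite -subr_eq0; apply/negP => /negP N.
have circE : integral_segment (fun u => P u y2 - P u y1) x1 x2 -
  integral_segment (fun v => Q x2 v - Q x1 v) y1 y2 = circ x1 y1 (x2 - x1) (y2 - y1).
  by rewrite /circ !(addrC _ (_ - _)) !subrK.
rewrite circE in N.
set s := x2 - x1 in N; set t := y2 - y1 in N; set M := `|circ x1 y1 s t|.
have M0 : 0 < M by rewrite normr_gt0.
have s0 : 0 <= s by rewrite subr_ge0.
have t0 : 0 <= t by rewrite subr_ge0.
pose bad n (p : R * R) := M / 4 ^+ n <= `|circ p.1 p.2 (s / 2 ^+ n) (t / 2 ^+ n)|.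
have half n (r : R) : r / 2 ^+ n.+1 = r / 2 ^+ n / 2.
  by rewrite exprSr invfM mulrA mulrAC.
pose next (np : nat * (R * R)) (q : R * R) := bad np.1 np.2 ->
  [/\ np.2.1 <= q.1 <= np.2.1 + s / 2 ^+ np.1.+1,
      np.2.2 <= q.2 <= np.2.2 + t / 2 ^+ np.1.+1 & bad np.1.+1 q].
have [|nx nxP] := @choice _ _ next.
  move=> [n [x y]]; rewrite /next /=.
  have [bad_nxy|] := pselect (bad n (x, y)); last by exists (x, y).
  have sn0 : 0 <= s / 2 ^+ n by rewrite divr_ge0 // exprn_ge0.
  have tn0 : 0 <= t / 2 ^+ n by rewrite divr_ge0 // exprn_ge0.
  have [x' [y' [xx yy b]]] := circ_quarter sn0 tn0 bad_nxy.
  exists (x', y') => _; rewrite !half; split=> //=.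
  by rewrite /bad !half exprSr invfM mulrA /=.
pose fix z n : R * R := if n is m.+1 then nx (m, z m) else (x1, y1).
have badz n : bad n (z n).
  elim: n => [|n IH]; first by rewrite /bad /= !expr0 !divr1.
  by have [] := nxP (n, z n) IH.
have [x xP] : exists x, forall n, (z n).1 <= x <= (z n).1 + s / 2 ^+ n.
  apply: (@nested_halving (fun n => (z n).1) (fun n => s / 2 ^+ n)) => n.
  - by rewrite divr_ge0 // exprn_ge0.
  - exact: half.
  - by have [] := nxP (n, z n) (badz n).
have [y yP] : exists y, forall n, (z n).2 <= y <= (z n).2 + t / 2 ^+ n.
  apply: (@nested_halving (fun n => (z n).2) (fun n => t / 2 ^+ n)) => n.
  - by rewrite divr_ge0 // exprn_ge0.
  - exact: half.
  - by have [] := nxP (n, z n) (badz n).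
(* This makes 2 * e * (s + t) ^ 2 smaller than M; the term + 1 keeps the
   denominator positive for a degenerate rectangle. *)
pose e := M / (4 * ((s + t) ^+ 2 + 1)).
have st0 : 0 < (s + t) ^+ 2 + 1 by exact: ltr_wpDl (sqr_ge0 _) ltr01.
have e0 : 0 < e by rewrite divr_gt0 // mulr_gt0.
have [d d0 dP] := @circ_local x y e e0.
have [n nd] : exists n, (s + t) / 2 ^+ n <= d.
  exists (Num.truncn ((s + t) / d)).+1.
  have n0 m : 0 < (2 : R) ^+ m by rewrite exprn_gt0.
  rewrite ler_pdivrMr // mulrC -ler_pdivrMr //.
  apply: ltW; apply: lt_trans (truncnS_gt _) _.
  by rewrite -natrX ltr_nat ltn_expl.
have n0 : 0 < (2 : R) ^+ n by rewrite exprn_gt0.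
have sn0 : 0 <= s / 2 ^+ n by rewrite divr_ge0 // ltW.
have tn0 : 0 <= t / 2 ^+ n by rewrite divr_ge0 // ltW.
have := dP (z n).1 (z n).2 (s / 2 ^+ n) (t / 2 ^+ n).
rewrite sn0 tn0 xP yP => /(_ _ _ isT isT).
rewrite mulrDl in nd.
move=> /(_ _ _)/(le_trans (badz n)) => /(_ _ _) => H.
have {H} : M / 4 ^+ n <= 2 * e * (s / 2 ^+ n + t / 2 ^+ n) ^+ 2 by apply: H => /=; lra.
have E4 : (2 ^+ n) ^+ 2 = 4 ^+ n :> R by rewrite -exprM mulnC exprM -natrX.
rewrite -mulrDl expr_div_n E4 mulrA ler_pM2r ?invr_gt0 ?exprn_gt0 //.
rewrite /e => H.
have : M * (4 * ((s + t) ^+ 2 + 1)) <= 2 * M * (s + t) ^+ 2.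
  have q0 : 0 < 4 * ((s + t) ^+ 2 + 1) by rewrite mulr_gt0.
  rewrite -ler_pdivlMr // (le_trans H) // le_eqVlt; apply/orP; left; apply/eqP.
  by field; rewrite gt_eqF.
by have := mulr_ge0 (ltW M0) (sqr_ge0 (s + t)); lra.
Qed.

End Goursat.

(** * Complex differentiability in real coordinates *)
Section ComplexDerivative.
Variable R : realType.
Local Open Scope complex_scope.
Local Notation C := R[i].
Local Notation normc := (@Normc.normc R).
Local Notation Re := (@complex.Re R).
Local Notation Im := (@complex.Im R).
Implicit Types (z w d : C) (g : C -> C).

Lemma norm_normc z : `|z| = (normc z)%:C.
Proof. by case: z. Qed.

Lemma normc_ge0 z : 0 <= normc z.
Proof. by rewrite -ler0c -norm_normc. Qed.

Lemma le_Re_normc z : `|Re z| <= normc z.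
Proof. by rewrite -lecR -norm_normc normc_ge_Re. Qed.

Lemma le_Im_normc z : `|Im z| <= normc z.
Proof. by rewrite -normrN -ReiNIm (le_trans (le_Re_normc _)) // Normc.normcM /= expr0n expr1n add0r sqrtr1 mulr1. Qed.

Lemma normc_le_ReIm (x y : R) : normc (x +i* y) <= `|x| + `|y|.
Proof.
have -> : x +i* y = x%:C + 'i%C * y%:C by rewrite [LHS]complexE.
rewrite (le_trans (le_normcD _ _)) // Normc.normcM /= !expr0n !expr1n /= add0r !addr0.
by rewrite sqrtr1 mul1r !sqrtr_sqr.
Qed.

(** d is the complex derivative of g at z. The estimate uses the real modulus
    normc, as the norm of R[i] takes its values in R[i]. *)
Definition cderivative g z d := forall e : R, 0 < e ->
  exists2 r, 0 < r & forall w, normc w <= r ->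
    normc (g (z + w) - g z - d * w) <= e * normc w.

Lemma normcD z w : normc (z + w) <= normc z + normc w.
Proof. exact: (@le_normcD R z w). Qed.

Lemma normcN z : normc (- z) = normc z.
Proof. exact: (@complex.normcN R z). Qed.

Lemma pos_complexE (e : C) : 0 < e -> exists2 r : R, 0 < r & e = r%:C.
Proof.
case: e => a b; rewrite ltcE /= => /andP[/eqP -> a0].
by exists a.
Qed.

Lemma differentiable_cderivative g z :
  differentiable (g : C^o -> C^o) (z : C^o) <-> exists d, cderivative g z d.
Proof.
rewrite -(derivable1_diffP (g : C^o -> C^o) (z : C^o)); split.
  move=> /cvg_ex[/= d /cvgrPdist_le dP]; exists d => e e0.
  have /dP : 0 < e%:C by rewrite ltcR.
  move=> /nbhs_normP/= [r' /pos_complexE[r r0 ->] rP].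
  exists (r / 2) => [|w wr]; first by rewrite divr_gt0.
  have [->|w0] := eqVneq w 0.
    by rewrite mulr0 addr0 !subrr /= expr0n /= addr0 sqrtr0 mulr0.
  have /= := rP w _ w0.
  rewrite sub0r normrN norm_normc ltcR (le_lt_trans wr) ?ltr_pdivrMr ?ltr_pMr ?ltr1n // => /(_ isT).
  rewrite [_%:A]mulr1 -(@ler_pM2r _ `|w|) ?normr_gt0 // -normrM mulrBl.
  rewrite /GRing.scale /= mulrAC mulVf // mul1r distrC.
  rewrite !norm_normc -[X in _ <= X](rmorphM (real_complex R)) lecR.
  by rewrite [w + z]addrC.
move=> [d dP]; apply/cvg_ex; exists d => /=; apply/cvgrPdist_le => e' /pos_complexE[e e0 ->].
have [r r0 rP] := dP e e0.
apply/nbhs_normP => /=; exists r%:C; first by rewrite /= ltcR.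
move=> w /=; rewrite sub0r normrN norm_normc ltcR => /ltW/rP wP w0.
rewrite [_%:A]mulr1 [w + z]addrC -(@ler_pM2r _ `|w|) ?normr_gt0 // -normrM mulrBl.
rewrite /GRing.scale /= mulrAC mulVf // mul1r distrC.
by rewrite !norm_normc -[X in _ <= X](rmorphM (real_complex R)) lecR.
Qed.

(** The Cauchy-Riemann equations: Im g dx + Re g dy, which is the imaginary
    part of g dz, is closed. *)
Lemma holomorphic_closed_form g : (forall z, differentiable (g : C^o -> C^o) (z : C^o)) ->
  closed_form (fun x y => Im (g (x +i* y))) (fun x y => Re (g (x +i* y))).
Proof.
move=> dg x y; have /differentiable_cderivative[[d1 d2] dP] := dg (x +i* y).
exists d2, d1, (- d2) => e e0.
have [r r0 rP] := dP e e0.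
exists (r / 2) => [|h k hr kr]; first by rewrite divr_gt0.
have hk : normc (h +i* k) <= `|h| + `|k| := normc_le_ReIm h k.
have := rP (h +i* k).
rewrite (le_trans hk) => [/(_ isT)|]; last by lra.
have -> : x +i* y + h +i* k = (x + h) +i* (y + k) by simpc.
set D := g _ - _ - _ => DP.
have {}DP : normc D <= e * (`|h| + `|k|).
  by rewrite (le_trans DP) // ler_pM2l.
split.
  apply: le_trans (le_trans (le_Im_normc D) DP).
  rewrite /D; case: (g _) => a b; case: (g _) => a' b' /=.
  by rewrite (addrC (d1 * k)).
apply: le_trans (le_trans (le_Re_normc D) DP).
rewrite /D; case: (g _) => a b; case: (g _) => a' b' /=.
by rewrite mulNr.
Qed.

End ComplexDerivative.

(** * The complex exponential *)
Section ComplexExp.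
Variable R : realType.
Local Open Scope complex_scope.
Local Notation C := R[i].
Local Notation normc := (@Normc.normc R).
Local Notation Re := (@complex.Re R).
Local Notation Im := (@complex.Im R).
Implicit Types (z w d : C) (g : C -> C).

Definition cexp z : C := (expR (Re z) * cos (Im z)) +i* (expR (Re z) * sin (Im z)).

Lemma cexpD z w : cexp (z + w) = cexp z * cexp w.
Proof.
case: z w => [a b] [c d]; rewrite /cexp /=; apply/eqP; rewrite eq_complex /=.
by rewrite expRD cosD sinD; apply/andP; split; apply/eqP; ring.
Qed.

Lemma cexp0 : cexp 0 = 1.
Proof. by rewrite /cexp /= expR0 cos0 sin0 mulr0 mulr1. Qed.

Lemma cexpN z : cexp (- z) = (cexp z)^-1.
Proof.
have E : cexp z * cexp (- z) = 1 by rewrite -cexpD subrr cexp0.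
have z0 : cexp z != 0.
  by apply/eqP => z0; have := oner_neq0 C; rewrite -E z0 mul0r eqxx.
by rewrite -[LHS](mulKf z0) E mulr1.
Qed.

Lemma normc_cexp z : normc (cexp z) = expR (Re z).
Proof.
rewrite /cexp /= !exprMn -mulrDr cos2Dsin2 mulr1 sqrtr_sqr.
by rewrite ger0_norm ?expR_ge0.
Qed.

Lemma cexp_neq0 z : cexp z != 0.
Proof.
apply/eqP => /(congr1 normc); rewrite normc_cexp Normc.normc0 => /eqP.
by rewrite gt_eqF ?expR_gt0.
Qed.

Lemma cexp_periodic z : cexp (z + 0 +i* (pi *+ 2)) = cexp z.
Proof. by case: z => a b; rewrite /cexp /= addr0 cosD2pi sinD2pi. Qed.

Lemma is_derive_bound (f : R -> R) (x l e : R) : is_derive x 1 f l -> 0 < e ->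
  exists2 r, 0 < r & forall h, `|h| <= r -> `|f (x + h) - f x - l * h| <= e * `|h|.
Proof.
move=> [df <-] e0; have /cvg_ex[/= d dP] := df.
have -> : 'D_1 f x = d by exact/cvg_lim.
move/cvgrPdist_le/(_ e e0): dP => /nbhs_normP/= [r r0 rP].
exists (r / 2) => [|w wr]; first by rewrite divr_gt0.
have [->|w0] := eqVneq w 0.
  by rewrite mulr0 addr0 !subrr normr0 mulr0.
have /= := rP w _ w0.
rewrite sub0r normrN (le_lt_trans wr) ?ltr_pdivrMr ?ltr_pMr ?ltr1n // => /(_ isT).
rewrite [_%:A]mulr1 -(@ler_pM2r _ `|w|) ?normr_gt0 // -normrM mulrBl.
rewrite /GRing.scale /= mulrAC mulVf // mul1r distrC.
by rewrite [w + x]addrC.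
Qed.

(** The real and imaginary parts of cexp w - 1 - w are
    (e^x - 1 - x) cos y + (1 + x) (cos y - 1) and
    (e^x - 1) sin y + (sin y - y), where each term is controlled by the
    derivative at 0 of a real function. *)
Lemma cexp_cderivative0 : cderivative cexp 0 1.
Proof.
move=> e e0.
(* The four terms are bounded by 1, 2, 4 and 1 times e' * normc w. *)
have [e' [e'0 e'1 e'e]] : exists e' : R, [/\ 0 < e', e' <= 1 & e' <= e / 10].
  exists (Num.min (e / 10) 1).
  by rewrite lt_min ltr01 divr_gt0 // !ge_min !lexx orbT.
have [r1 r10 r1P] := is_derive_bound (is_derive_expR 0) e'0.
have [r2 r20 r2P] := is_derive_bound (is_derive_cos 0) e'0.
have [r3 r30 r3P] := is_derive_bound (is_derive_sin 0) e'0.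
pose r := Num.min (Num.min r1 r2) (Num.min r3 e').
exists r => [|[x y] wr]; first by rewrite !lt_min r10 r20 r30 e'0.
have xr : `|x| <= r by exact: le_trans (le_Re_normc (x +i* y)) wr.
have yr : `|y| <= r by exact: le_trans (le_Im_normc (x +i* y)) wr.
have xw := le_Re_normc (x +i* y); have yw := le_Im_normc (x +i* y).
move: xr yr; rewrite /r !le_min => /andP[/andP[x1 _] /andP[_ xe]] /andP[/andP[_ y2] /andP[y3 ye]].
move: (r1P _ x1) (r2P _ y2) (r3P _ y3).
rewrite !add0r cexp0 expR0 cos0 sin0 oppr0 mul0r addr0 !subr0 !mul1r => E C1 S1.
rewrite /cexp; set ex := expR x in E *; set cy := cos y in C1 *; set sy := sin y in S1 *.
have cy1 : `|cy| <= 1 by rewrite ler_norml cos_geN1 cos_le1.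
have sy1 : `|sy| <= 2 * `|y|.
  rewrite -[sy](subrK y) (le_trans (ler_normD _ _)) // mulrDl mul1r lerD2r.
  by rewrite (le_trans S1) // ler_piMl.
have ex1 : `|ex - 1| <= 2 * e'.
  rewrite -[ex - 1](subrK x) (le_trans (ler_normD _ _)) // mulrDl mul1r lerD //.
  by rewrite (le_trans E) // ler_piMr ?(ltW e'0) ?(le_trans xe).
apply: le_trans (normc_le_ReIm _ _) _.
have -> : ex * cy - 1 - x = (ex - 1 - x) * cy + (1 + x) * (cy - 1) by ring.
have -> : ex * sy - 0 - y = (ex - 1) * sy + (sy - y) by ring.
set n := normc _ in xw yw *; have n0 : 0 <= n := normc_ge0 _.
have H1 : `|(ex - 1 - x) * cy| <= e' * n.
  rewrite normrM (le_trans (ler_pM _ _ E cy1)) // mulr1 ler_pM2l //.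
have H2 : `|(1 + x) * (cy - 1)| <= 2 * e' * n.
  have x2 : `|1 + x| <= 2.
    by rewrite (le_trans (ler_normD _ _)) // normr1; lra.
  rewrite normrM (le_trans (ler_pM _ _ x2 C1)) // mulrA ler_pM2l // mulr_gt0 //.
have H3 : `|(ex - 1) * sy| <= 4 * e' * n.
  rewrite normrM (le_trans (ler_pM _ _ ex1 sy1)) //.
  by have : e' * `|y| <= e' * n; [rewrite ler_pM2l | lra].
have H4 : `|sy - y| <= e' * n.
  by rewrite (le_trans S1) // ler_pM2l.
apply: le_trans (lerD (ler_normD _ _) (ler_normD _ _)) _.
have en : 10 * (e' * n) <= e * n by rewrite mulrA ler_wpM2r //; lra.
apply: le_trans (lerD (lerD H1 H2) (lerD H3 H4)) (le_trans _ en).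
have := mulr_ge0 (ltW e'0) n0; lra.
Qed.

Lemma cexp_differentiable z : differentiable (cexp : C^o -> C^o) (z : C^o).
Proof.
apply/differentiable_cderivative; exists (cexp z) => e e0.
have ez : 0 < e / normc (cexp z) by rewrite divr_gt0 // normc_cexp expR_gt0.
have [r r0 rP] := cexp_cderivative0 ez.
exists r => // w /rP; rewrite add0r cexp0 mul1r => wP.
rewrite cexpD -[cexp z in X in _ - X - _]mulr1 -!mulrBr Normc.normcM mulrC.
by rewrite -ler_pdivlMr ?normc_cexp ?expR_gt0 // -normc_cexp mulrAC.
Qed.

End ComplexExp.

(** * Liouville's theorem *)
Section Liouville.
Variable R : realType.
Local Open Scope complex_scope.
Local Notation C := R[i].
Local Notation normc := (@Normc.normc R).
Local Notation Re := (@complex.Re R).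
Local Notation Im := (@complex.Im R).
Implicit Types (z w d : C) (g : C -> C).

Definition entire g := forall z : C, differentiable (g : C^o -> C^o) (z : C^o).

Definition sublinear g := forall e : R, 0 < e ->
  exists M : R, forall z, M <= normc z -> normc (g z) <= e * normc z.

Lemma entire_mulC g c : entire g -> entire (fun z => c * g z).
Proof. by move=> eg z; exact: (@differentiableZ _ C^o C^o g c (z : C^o)). Qed.

Lemma sublinear_mulC g c : sublinear g -> sublinear (fun z => c * g z).
Proof.
move=> sg e e0.
have c0 : 0 < normc c + 1 by rewrite ltr_wpDl ?normc_ge0.
have [M MP] := sg (e / (normc c + 1)) (divr_gt0 e0 c0).
exists M => z /MP; rewrite mulrAC ler_pdivlMr // => /(le_trans _); apply.
by rewrite Normc.normcM mulrC ler_wpM2l ?normc_ge0 // lerDl.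
Qed.

Lemma entire_Re_continuous g x : entire g -> continuous (fun y => Re (g (x +i* y))).
Proof.
move=> eg; apply: linear_bound_continuous => y.
have [p1 [p2 [q2 /(_ 1 ltr01)[r r0 H]]]] := holomorphic_closed_form eg x y.
exists q2, r => // k kr.
have [] := H 0 k _ kr; first by rewrite normr0 ltW.
by rewrite !addr0 normr0 !mulr0 !add0r mul1r.
Qed.

(** In the rectangle [x1, x2] x [0, 2 pi] the horizontal sides cancel by
    periodicity, so Goursat's theorem compares the vertical ones. *)
Lemma periodic_mean_constant g : entire g ->
  (forall z, g (z + 0 +i* (pi *+ 2)) = g z) ->
  forall x1 x2, x1 <= x2 ->
  integral_segment (fun y => Re (g (x1 +i* y))) 0 (pi *+ 2) =
  integral_segment (fun y => Re (g (x2 +i* y))) 0 (pi *+ 2).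
Proof.
move=> eg per x1 x2 x12.
have pi0 : 0 <= pi *+ 2 :> R by rewrite mulrn_wge0 // pi_ge0.
have := goursat (holomorphic_closed_form eg) x12 pi0.
have -> : (fun u => Im (g (u +i* (pi *+ 2))) - Im (g (u +i* 0))) = cst 0.
  apply/funext => u /=; rewrite -(per (u +i* 0)).
  have -> : u +i* 0 + 0 +i* (pi *+ 2) = u +i* (pi *+ 2) :> C by simpc.
  by rewrite subrr.
have I0 : integral_segment (cst 0) x1 x2 = 0 :> R.
  apply/eqP; rewrite -normr_le0 -[X in `|X|]subr0 -[X in _ - X](mul0r (x2 - x1)).
  rewrite -[leRHS](mul0r (x2 - x1)).
  apply: integral_segment_near_cst => // [|u _]; first exact: cst_continuous.
  by rewrite subr0 normr0.
rewrite I0 integral_segmentB; first last.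
- exact: entire_Re_continuous.
- exact: entire_Re_continuous.
by move=> /esym/eqP; rewrite subr_eq0 => /eqP.
Qed.

(** Substitute z = a + cexp w in the difference quotient (g z - g a) / (z - a).
    The result G is entire and 2 pi i-periodic, so its mean over a vertical
    period does not depend on Re w. As Re w tends to -oo, G tends to the
    derivative d; as Re w tends to +oo, it tends to 0, since g is sublinear. *)
Lemma sublinear_entire_Re_derivative g a d : entire g -> sublinear g ->
  cderivative g a d -> Re d = 0.
Proof.
move=> eg sg da.
pose G w := (g (a + cexp w) - g a) * cexp (- w).
have eG : entire G.
  move=> w; apply: (@differentiableM _ C^o (fun w => g (a + cexp w) - g a)).
    apply: differentiableB => //.
    apply: (@differentiable_comp _ C^o C^o C^o (fun w => a + cexp w) g); last exact: eg.
    by apply: differentiableD => //; exact: cexp_differentiable.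
  apply: (@differentiable_comp _ C^o C^o C^o -%R (@cexp R)).
    exact: differentiableN.
  exact: cexp_differentiable.
have perG z : G (z + 0 +i* (pi *+ 2)) = G z.
  by rewrite /G !cexpN !cexp_periodic.
have normG w : normc (G w) = normc (g (a + cexp w) - g a) / expR (Re w).
  by rewrite /G cexpN Normc.normcM Normc.normcV normc_cexp.
have pi0 : 0 < pi *+ 2 :> R by rewrite mulrn_wgt0 // pi_gt0.
have mean x k e : (forall y, `|Re (G (x +i* y)) - k| <= e) ->
    `|integral_segment (fun y => Re (G (x +i* y))) 0 (pi *+ 2) - k * (pi *+ 2)|
      <= e * (pi *+ 2).
  move=> H.
  have := integral_segment_near_cst (@entire_Re_continuous _ x eG) (ltW pi0) (fun y _ => H y).
  by rewrite subr0.
have left e : 0 < e -> exists x0, forall x, x <= x0 ->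
    forall y, `|Re (G (x +i* y)) - Re d| <= e.
  move=> e0; have [r r0 rP] := da e e0; exists (ln r) => x xr y.
  have er : normc (cexp (x +i* y)) <= r.
    by rewrite normc_cexp /= -(lnK (x := r)) ?ler_expR // posrE.
  have := rP _ er; rewrite normc_cexp -ler_pdivrMr ?expR_gt0 // => H.
  apply: le_trans H; rewrite -normc_cexp -Normc.normcV -Normc.normcM mulrBl.
  rewrite mulfK ?cexp_neq0 // -cexpN -/(G _).
  by apply: le_trans (le_Re_normc _); case: (G _) (d) => [? ?] [? ?].
have right e : 0 < e -> exists x0, forall x, x0 <= x ->
    forall y, `|Re (G (x +i* y)) - 0| <= e.
  move=> e0; have e40 : 0 < e / 4 by rewrite divr_gt0.
  have [M MP] := sg (e / 4) e40.
  have ga0 : 0 <= normc (g a) / (e / 4) by rewrite divr_ge0 ?normc_ge0 // ltW.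
  have a0 : 0 <= normc a by exact: normc_ge0.
  have M0 : 0 <= `|M| by [].
  have MM : M <= `|M| by exact: ler_norm.
  (* For r = normc (z - a) at least the argument of ln, M <= normc z,
     normc a <= r and normc (g a) <= e / 4 * r; the 1 makes it positive. *)
  exists (ln (1 + `|M| + normc a + normc (g a) / (e / 4))) => x xN y.
  rewrite subr0 (le_trans (le_Re_normc _)) // normG ler_pdivrMr ?expR_gt0 //=.
  set w := x +i* y.
  have : expR (ln (1 + `|M| + normc a + normc (g a) / (e / 4))) <= expR x.
    by rewrite ler_expR.
  rewrite lnK ?posrE; last by lra.
  have := normc_cexp w; rewrite [complex.Re w]/=; set r := expR x => wr rN.
  have aw1 : normc (cexp w) <= normc (a + cexp w) + normc a.
    by rewrite -(normcN a) -{1}[cexp w](addKr a) addrC normcD.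
  have aw2 := normcD a (cexp w).
  have {}MP : normc (g (a + cexp w)) <= e / 4 * (normc a + r).
    apply: le_trans (MP _ _) _; first by lra.
    by rewrite ler_pM2l //; lra.
  have gar : normc (g a) <= e / 4 * r by rewrite mulrC -ler_pdivrMr //; lra.
  have aer : e / 4 * normc a <= e / 4 * r by rewrite ler_pM2l //; lra.
  have er : 0 <= e / 4 * r by rewrite mulr_ge0 ?ltW // expR_gt0.
  apply: le_trans (normcD _ _) _; rewrite normcN; lra.
apply/eqP; rewrite -normr_le0; apply/ler_addgt0Pr => e e0; rewrite add0r.
have e20 : 0 < e / 2 by rewrite divr_gt0.
have [x1 H1] := left _ e20; have [x2 H2] := right _ e20.
have x12 : Num.min x1 x2 <= Num.max x1 x2 by rewrite ge_min le_max lexx.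
have x1l : Num.min x1 x2 <= x1 by rewrite ge_min lexx.
have x2l : x2 <= Num.max x1 x2 by rewrite le_max lexx orbT.
have := mean _ _ _ (H1 _ x1l); rewrite (periodic_mean_constant eG perG x12).
have := mean _ _ _ (H2 _ x2l); rewrite mul0r subr0.
set I := integral_segment _ _ _ => I1 I2.
rewrite -(ler_pM2r pi0) -{1}(ger0_norm (ltW pi0)) -normrM.
rewrite -(subrK I (_ * _)) (le_trans (ler_normD _ _)) // distrC.
by rewrite [e in _ <= e * _]splitr mulrDl lerD.
Qed.

Lemma sublinear_entire_derivative g a d : entire g -> sublinear g ->
  cderivative g a d -> d = 0.
Proof.
move=> eg sg da; apply/eqP; rewrite eq_complex (sublinear_entire_Re_derivative eg sg da) eqxx /=.
rewrite -oppr_eq0 -ReiNIm; apply/eqP.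
apply: (@sublinear_entire_Re_derivative (fun z => 'i * g z) a).
- exact: entire_mulC.
- exact: sublinear_mulC.
move=> e /da[r r0 rP]; exists r => // w /rP.
rewrite -(mulrC 'i) -mulrA -!mulrBr Normc.normcM /=.
by rewrite expr0n expr1n add0r sqrtr1 mul1r.
Qed.

Lemma sublinear_entire_Re_constant g z : entire g -> sublinear g ->
  Re (g z) = Re (g 0).
Proof.
move=> eg sg; pose f (t : R) := Re (g (t%:C * z)).
have df (t : R) : is_derive t 1 f 0.
  have dg0 : cderivative g (t%:C * z) 0.
    have /differentiable_cderivative[d dP] := eg (t%:C * z).
    by rewrite -(sublinear_entire_derivative eg sg dP).
  suff cv : h^-1 *: (f (h *: 1 + t) - f t) @[h --> 0^'] --> 0.
    by split; [apply/cvg_ex; exists 0 | exact/cvg_lim].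
  apply/cvgrPdist_le => e e0.
  have z0 : 0 < normc z + 1 by rewrite ltr_wpDl ?normc_ge0.
  have [r r0 rP] := dg0 (e / (normc z + 1)) (divr_gt0 e0 z0).
  apply/nbhs_normP => /=; exists (r / (normc z + 1)); first by rewrite /= divr_gt0.
  move=> h /=; rewrite sub0r normrN ltr_pdivlMr // => hr h0.
  rewrite sub0r normrN normrM normfV mulrC ler_pdivrMr ?normr_gt0 //.
  have hz : normc (h%:C * z) = `|h| * normc z.
    by rewrite Normc.normcM /= expr0n /= addr0 sqrtr_sqr.
  have := rP (h%:C * z); rewrite hz mul0r subr0 -mulrDl -rmorphD /=.
  have hn : `|h| * normc z <= `|h| * (normc z + 1) by rewrite ler_wpM2l // lerDl.
  move=> /(_ (le_trans hn (ltW hr))) H.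
  rewrite /f [h *: 1]mulr1 [h + t]addrC.
  have B : e / (normc z + 1) * (`|h| * normc z) <= e * `|h|.
    by rewrite mulrAC ler_pdivrMr // -mulrA ler_wpM2l // ltW.
  apply: le_trans (le_trans H B); apply: le_trans (le_Re_normc _).
  by case: (g _) (g _) => [? ?] [? ?].
have := is_derive_0_is_cst 1 0 df.
by rewrite /f mul1r mul0r.
Qed.

Lemma liouville g : entire g -> sublinear g -> forall z, g z = g 0.
Proof.
move=> eg sg z; apply/eqP; rewrite eq_complex.
rewrite (sublinear_entire_Re_constant _ eg sg) eqxx /= -eqr_opp -!ReiNIm.
rewrite [g z * _]mulrC [g 0 * _]mulrC; apply/eqP.
exact: (sublinear_entire_Re_constant z (entire_mulC 'i eg) (sublinear_mulC 'i sg)).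
Qed.

(** The sections of O(1) over the projective line are linear: g and h are one
    section in the two standard charts, and g z - z * h 0, which is
    z * (h (1/z) - h 0), is sublinear because h is continuous at 0. *)
Lemma section_line_affine g h : entire g -> entire h ->
  (forall z, z != 0 -> g z = z * h z^-1) -> forall z, g z = g 0 + z * h 0.
Proof.
move=> eg eh gh z; pose k z := g z - z * h 0.
suff kk : k z = k 0 by move/eqP: kk; rewrite /k mul0r subr0 subr_eq => /eqP.
apply: liouville => [{}z|e e0].
  by apply: differentiableB.
have /differentiable_cderivative[d dP] := eh 0.
have [r r0 rP] := dP 1 ltr01.
have d1 : 0 < 1 + normc d by rewrite ltr_pwDl ?normc_ge0.
pose M := Num.max r^-1 ((1 + normc d) / e).
exists M => {}z zM.
have zr : r^-1 <= normc z by rewrite (le_trans _ zM) // le_max lexx.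
have ze : (1 + normc d) / e <= normc z by rewrite (le_trans _ zM) // le_max lexx orbT.
have nz0 : 0 < normc z by rewrite (lt_le_trans _ zr) // invr_gt0.
have z0 : z != 0 by apply: contraTneq nz0 => ->; rewrite Normc.normc0 ltxx.
rewrite /k gh // -mulrBr Normc.normcM mulrC ler_pM2r //.
have vz : (normc z)^-1 <= r by rewrite -[r]invrK lef_pV2 // posrE invr_gt0.
have := rP z^-1; rewrite add0r Normc.normcV => /(_ vz); rewrite mul1r => H.
rewrite -[h z^-1 - h 0](subrK (d * z^-1)) (le_trans (normcD _ _)) //.
rewrite Normc.normcM Normc.normcV.
apply: le_trans (lerD H (lexx _)) _.
by rewrite -{1}[(normc z)^-1]mul1r -mulrDl ler_pdivrMr // mulrC -ler_pdivrMr.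
Qed.

End Liouville.

(** * Functions that are additive on null vectors *)
Section NullVectors.
Variable K : numFieldType.
Local Notation V := (imoct K).

(** Coordinates in which the quadratic form is 4 (a . b - c ^ 2), so that the
    vectors with b = c = 0 and those with a = c = 0 form isotropic
    3-spaces. *)
Definition split_vec (a1 a2 a3 b1 b2 b3 c : K) : V :=
  \row_(i < 7) [:: a1 + b1; a2 + b2; a3 + b3; a1 - b1; a2 - b2; a3 - b3; 2 * c]`_i.

Lemma split_vecD a1 a2 a3 b1 b2 b3 c a1' a2' a3' b1' b2' b3' c' :
  split_vec a1 a2 a3 b1 b2 b3 c + split_vec a1' a2' a3' b1' b2' b3' c' =
  split_vec (a1 + a1') (a2 + a2') (a3 + a3') (b1 + b1') (b2 + b2') (b3 + b3') (c + c').
Proof.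
apply/rowP.
by case=> [[|[|[|[|[|[|[|//]]]]]]] ?]; do ![rewrite mxE /=]; ring.
Qed.

Lemma split_vecZ k a1 a2 a3 b1 b2 b3 c :
  k *: split_vec a1 a2 a3 b1 b2 b3 c =
  split_vec (k * a1) (k * a2) (k * a3) (k * b1) (k * b2) (k * b3) (k * c).
Proof.
apply/rowP.
by case=> [[|[|[|[|[|[|[|//]]]]]]] ?]; do ![rewrite mxE /=]; ring.
Qed.

Lemma quad_split_vec a1 a2 a3 b1 b2 b3 c :
  quad (split_vec a1 a2 a3 b1 b2 b3 c) =
  4 * (a1 * b1 + a2 * b2 + a3 * b3 - c ^+ 2).
Proof. by rewrite quadE; do ![rewrite mxE /=]; ring. Qed.

Lemma split_vecE (x : V) : x = split_vec
  ((x 0 0 + x 0 3) / 2) ((x 0 1 + x 0 4) / 2) ((x 0 2 + x 0 5) / 2)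
  ((x 0 0 - x 0 3) / 2) ((x 0 1 - x 0 4) / 2) ((x 0 2 - x 0 5) / 2)
  (x 0 6 / 2).
Proof.
apply/rowP.
case=> [[|[|[|[|[|[|[|//]]]]]]] Hi]; do ![rewrite mxE /=].
- have -> : Ordinal Hi = 0 by apply: val_inj. by field.
- have -> : Ordinal Hi = 1 by apply: val_inj. by field.
- have -> : Ordinal Hi = 2 by apply: val_inj. by field.
- have -> : Ordinal Hi = 3 by apply: val_inj. by field.
- have -> : Ordinal Hi = 4 by apply: val_inj. by field.
- have -> : Ordinal Hi = 5 by apply: val_inj. by field.
- have -> : Ordinal Hi = 6 by apply: val_inj. by field.
Qed.

(** The coefficient of c is supplied by the null vector (1, 0, 0, 1, 0, 0, 1),
    and what remains splits between the two isotropic 3-spaces. *)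
Lemma null_span (P : V -> Prop) :
  (forall x, quad x = 0 -> P x) -> (forall k x y, P x -> P y -> P (k *: x + y)) ->
  forall x, P x.
Proof.
move=> Pnull PD x; rewrite (split_vecE x).
move: (_ / 2) (_ / 2) (_ / 2) (_ / 2) (_ / 2) (_ / 2) (_ / 2) => c b3 b2 b1 a3 a2 a1.
have -> : split_vec a1 a2 a3 b1 b2 b3 c = c *: split_vec 1 0 0 1 0 0 1 +
    (1 *: split_vec (a1 - c) a2 a3 0 0 0 0 + split_vec 0 0 0 (b1 - c) b2 b3 0).
  by rewrite !split_vecZ !split_vecD; congr split_vec; ring.
apply: (PD); [|apply: (PD)]; apply: Pnull; rewrite quad_split_vec; ring.
Qed.

(** Write x = (a, b, c), where x is null iff a . b = c ^ 2. On the two isotropic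
    3-spaces F is linear, hence so it is on the null vectors with c = 0, as
    (a, b, 0) = (a, 0, 0) + (0, b, 0). For c = 1 let D be the difference of F
    and this linear function. It does not change when a is replaced by another
    a' with a' . b = 1, because (a - a', 0, 0) is null, and similarly for b.
    Such moves connect all the pairs with a . b = 1, so D is constant, and
    this constant is the coefficient of c in the linear form sought. *)
Lemma null_additive_linear (F : V -> K) :
  (forall k x, quad x = 0 -> F (k *: x) = k * F x) ->
  (forall x y, quad x = 0 -> quad y = 0 -> quad (x + y) = 0 ->
     F (x + y) = F x + F y) ->
  exists w, forall x, quad x = 0 -> F x = dot w x.
Proof.
move=> FZ FD.
pose al a1 a2 a3 := a1 * F (split_vec 1 0 0 0 0 0 0)
  + a2 * F (split_vec 0 1 0 0 0 0 0) + a3 * F (split_vec 0 0 1 0 0 0 0).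
pose be b1 b2 b3 := b1 * F (split_vec 0 0 0 1 0 0 0)
  + b2 * F (split_vec 0 0 0 0 1 0 0) + b3 * F (split_vec 0 0 0 0 0 1 0).
have Fa a1 a2 a3 : F (split_vec a1 a2 a3 0 0 0 0) = al a1 a2 a3.
  have -> : split_vec a1 a2 a3 0 0 0 0 = a1 *: split_vec 1 0 0 0 0 0 0
      + a2 *: split_vec 0 1 0 0 0 0 0 + a3 *: split_vec 0 0 1 0 0 0 0.
    by rewrite !split_vecZ !split_vecD; congr split_vec; ring.
  rewrite !FD ?FZ //; rewrite ?split_vecZ ?split_vecD quad_split_vec; ring.
have Fb b1 b2 b3 : F (split_vec 0 0 0 b1 b2 b3 0) = be b1 b2 b3.
  have -> : split_vec 0 0 0 b1 b2 b3 0 = b1 *: split_vec 0 0 0 1 0 0 0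
      + b2 *: split_vec 0 0 0 0 1 0 0 + b3 *: split_vec 0 0 0 0 0 1 0.
    by rewrite !split_vecZ !split_vecD; congr split_vec; ring.
  rewrite !FD ?FZ //; rewrite ?split_vecZ ?split_vecD quad_split_vec; ring.
pose D a1 a2 a3 b1 b2 b3 :=
  F (split_vec a1 a2 a3 b1 b2 b3 1) - al a1 a2 a3 - be b1 b2 b3.
have Da a1 a2 a3 a1' a2' a3' b1 b2 b3 : a1 * b1 + a2 * b2 + a3 * b3 = 1 ->
    a1' * b1 + a2' * b2 + a3' * b3 = 1 -> D a1 a2 a3 b1 b2 b3 = D a1' a2' a3' b1 b2 b3.
  move=> ab a'b; rewrite /D.
  have -> : split_vec a1 a2 a3 b1 b2 b3 1 = split_vec a1' a2' a3' b1 b2 b3 1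
     + split_vec (a1 - a1') (a2 - a2') (a3 - a3') 0 0 0 0.
    by rewrite split_vecD; congr split_vec; ring.
  rewrite FD ?Fa; first by rewrite /al; ring.
  - by rewrite quad_split_vec a'b; ring.
  - by rewrite quad_split_vec; ring.
  - rewrite split_vecD quad_split_vec.
    by transitivity (4 * (a1 * b1 + a2 * b2 + a3 * b3 - 1)); [ring | rewrite ab; ring].
have Db a1 a2 a3 b1 b2 b3 b1' b2' b3' : a1 * b1 + a2 * b2 + a3 * b3 = 1 ->
    a1 * b1' + a2 * b2' + a3 * b3' = 1 -> D a1 a2 a3 b1 b2 b3 = D a1 a2 a3 b1' b2' b3'.
  move=> ab a'b; rewrite /D.
  have -> : split_vec a1 a2 a3 b1 b2 b3 1 = split_vec a1 a2 a3 b1' b2' b3' 1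
     + split_vec 0 0 0 (b1 - b1') (b2 - b2') (b3 - b3') 0.
    by rewrite split_vecD; congr split_vec; ring.
  rewrite FD ?Fb; first by rewrite /be; ring.
  - by rewrite quad_split_vec a'b; ring.
  - by rewrite quad_split_vec; ring.
  - rewrite split_vecD quad_split_vec.
    by transitivity (4 * (a1 * b1 + a2 * b2 + a3 * b3 - 1)); [ring | rewrite ab; ring].
pose ka := D 1 0 0 1 0 0.
have Dk0 a1 a2 a3 b1 b2 b3 : a1 * b1 + a2 * b2 + a3 * b3 = 1 -> b2 != 0 ->
    D a1 a2 a3 b1 b2 b3 = ka.
  move=> ab b20.
  rewrite (Da _ _ _ 1 ((1 - b1) / b2) 0 _ _ _ ab) ?divfK //; last by ring.
  rewrite (Db _ _ _ _ _ _ 1 0 0) ?divfK //; [|ring..].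
  rewrite (Da _ _ _ 1 0 0) //; ring.
have Dk a1 a2 a3 b1 b2 b3 : a1 * b1 + a2 * b2 + a3 * b3 = 1 ->
    D a1 a2 a3 b1 b2 b3 = ka.
  move=> ab; have [b20|] := eqVneq b2 0; last exact: Dk0.
  have ab' : a1 * b1 + 0 * b2 + a3 * b3 = 1 by rewrite -ab b20; ring.
  have ab'' : a1 * b1 + 0 * 1 + a3 * b3 = 1 by rewrite -ab b20; ring.
  by rewrite (Da _ _ _ _ _ _ _ _ _ ab ab') (Db _ _ _ _ _ _ _ _ _ ab' ab'') Dk0 // oner_eq0.
have Fs a1 a2 a3 b1 b2 b3 c : a1 * b1 + a2 * b2 + a3 * b3 = c ^+ 2 ->
    F (split_vec a1 a2 a3 b1 b2 b3 c) = al a1 a2 a3 + be b1 b2 b3 + c * ka.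
  move=> abc; have [c0|c0] := eqVneq c 0.
    rewrite c0 mul0r addr0 -Fa -Fb -FD; first by rewrite split_vecD !(addr0, add0r).
    - by rewrite quad_split_vec; ring.
    - by rewrite quad_split_vec; ring.
    - by rewrite split_vecD quad_split_vec !(addr0, add0r) abc c0; ring.
  have ab1 : a1 / c * (b1 / c) + a2 / c * (b2 / c) + a3 / c * (b3 / c) = 1.
    have -> : a1 / c * (b1 / c) + a2 / c * (b2 / c) + a3 / c * (b3 / c) =
      (a1 * b1 + a2 * b2 + a3 * b3) / c ^+ 2 by field.
    by rewrite abc divff // expf_neq0.
  rewrite -(Dk _ _ _ _ _ _ ab1).
  have -> : split_vec a1 a2 a3 b1 b2 b3 c = c *: split_vec (a1 / c) (a2 / c) (a3 / c) (b1 / c) (b2 / c) (b3 / c) 1.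
    by rewrite split_vecZ; congr split_vec; field.
  rewrite FZ; last by rewrite quad_split_vec ab1; ring.
  by rewrite /D /al /be; field.
clearbody ka.
pose A1 := F (split_vec 1 0 0 0 0 0 0); pose A2 := F (split_vec 0 1 0 0 0 0 0).
pose A3 := F (split_vec 0 0 1 0 0 0 0); pose B1 := F (split_vec 0 0 0 1 0 0 0).
pose B2 := F (split_vec 0 0 0 0 1 0 0); pose B3 := F (split_vec 0 0 0 0 0 1 0).
exists (\row_(i < 7) [:: (A1 + B1) / 2; (A2 + B2) / 2; (A3 + B3) / 2;
  (B1 - A1) / 2; (B2 - A2) / 2; (B3 - A3) / 2; - ka / 2]`_i).
move=> x; rewrite {1 2}(split_vecE x) quad_split_vec => /eqP.
rewrite mulf_eq0 pnatr_eq0 /= subr_eq0 => /eqP/Fs ->.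
rewrite dotE !mxE /= /al /be -/A1 -/A2 -/A3 -/B1 -/B2 -/B3; by field.
Qed.

End NullVectors.

(** * Holomorphic functions on the cone of null vectors *)
Section HolomorphicAlong.
Variables (K : numFieldType) (V : normedModType K) (T : Type) (j : T -> V).

Lemma holomorphic_along_line (f : T -> K^o) (l : K^o -> T) (v w : V) :
  (forall t, j (l t) = v + t *: w) -> holomorphic_along j f ->
  forall t : K^o, differentiable (f \o l : K^o -> K^o) t.
Proof.
move=> jl hf t; have [F FP] := hf (l t).
pose a (t : K^o) : V := v + t *: w.
have da : differentiable a t by apply: differentiableD => //; exact: differentiableZl.
rewrite jl in FP.
apply/derivable1_diffP; apply: (near_eq_derivable (f := (F \o a : K^o -> K^o))).
  have ca : a @ nbhs t --> a t := differentiable_continuous da.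
  have := ca _ FP; rewrite /fmap /=.
  apply: (@filterS K^o (nbhs t) (nbhs_filter _)) => u [_ H] /=.
  by rewrite (H (l u)).
apply/derivable1_diffP; apply: differentiable_comp => //.
by have [] := nbhs_singleton FP.
Qed.

Lemma holomorphic_along_slicel (f : T * T -> K^o) y :
  holomorphic_along (fun xy => (j xy.1, j xy.2)) f ->
  holomorphic_along j (fun x => f (x, y)).
Proof.
move=> hf x; have [F FP] := hf (x, y).
exists (fun v => F (v, j y)).
have dp v : differentiable (fun v : V => (v, j y)) v by exact: differentiable_pair.
have cp : (fun v : V => (v, j y)) @ nbhs (j x) --> (j x, j y) :=
  differentiable_continuous (dp (j x)).
have := cp _ FP; rewrite /fmap /=.
apply: (@filterS V (nbhs (j x)) (nbhs_filter _)) => v [dF H]; split.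
  exact: (differentiable_comp (f := fun v : V => (v, j y))).
by move=> u ju; apply: (H (u, y)); rewrite /= ju.
Qed.

Lemma holomorphic_along_slicer (f : T * T -> K^o) x :
  holomorphic_along (fun xy => (j xy.1, j xy.2)) f ->
  holomorphic_along j (fun y => f (x, y)).
Proof.
move=> hf y; have [F FP] := hf (x, y).
exists (fun v => F (j x, v)).
have dp v : differentiable (fun v : V => (j x, v)) v by exact: differentiable_pair.
have cp : (fun v : V => (j x, v)) @ nbhs (j y) --> (j x, j y) :=
  differentiable_continuous (dp (j y)).
have := cp _ FP; rewrite /fmap /=.
apply: (@filterS V (nbhs (j y)) (nbhs_filter _)) => v [dF H]; split.
  exact: (differentiable_comp (f := fun v : V => (j x, v))).
by move=> u ju; apply: (H (x, u)); rewrite /= ju.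
Qed.

End HolomorphicAlong.

Section ConeFunctions.
Variable R : realType.
Local Notation C := R[i].
Local Notation IC := (imoct C).
Local Notation cone := (cone R).

Definition homogeneous (f : cone -> C) :=
  forall (k : C) (x y : cone), y = k *: (x : IC) :> IC -> f y = k * f x.

Lemma quadD (x y : IC) : quad (x + y) = quad x + quad y + 2 * dot x y.
Proof. by rewrite !quadE dotE !mxE; ring. Qed.

Lemma dotZr k (x y : IC) : dot x (k *: y) = k * dot x y.
Proof. by rewrite !dotE !mxE; ring. Qed.

Lemma cone_additive_entire (f : cone -> C) (x y : cone) :
  holomorphic_along (@cone_val R) f ->
  (forall t : C, (x : IC) + t *: (y : IC) != 0 :> IC) -> dot x y = 0 ->
  exists2 g : C -> C, entire g &
    forall (t : C) (z : cone), z = (x : IC) + t *: (y : IC) :> IC -> g t = f z.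
Proof.
move=> hf xy0 xy.
have Q0 t : quad ((x : IC) + t *: (y : IC)) = 0.
  by rewrite quadD quadZ !cone_null dotZr xy; ring.
pose line t := MkCone (xy0 t) (Q0 t).
exists (f \o line); last by move=> t z zE; congr f; apply: cone_eq; rewrite zE.
by move=> t; apply: (@holomorphic_along_line C IC cone (@cone_val R) f line x y _ hf t).
Qed.

(** As x, y and x + y are null, x and y are orthogonal and the plane that they
    span is isotropic. If they are independent, f restricts to a section of
    O(1) over the projective line of this plane; otherwise homogeneity is
    enough. *)
Lemma cone_additive (f : cone -> C) (x y z : cone) :
  homogeneous f -> holomorphic_along (@cone_val R) f ->
  z = (x : IC) + y :> IC -> f z = f x + f y.
Proof.
move=> hom hf zE.
have [[k yE]|indep] := pselect (exists k, y = k *: (x : IC) :> IC).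
  rewrite (hom k x y yE) (hom (1 + k) x z) ?mulrDl ?mul1r //.
  by rewrite zE yE scalerDl scale1r.
have xy : dot x y = 0.
  by rewrite /dot -zE !cone_null !subr0 mulr0.
have x_ty t : (x : IC) + t *: (y : IC) != 0 :> IC.
  have [->|t0] := eqVneq t 0; first by rewrite scale0r addr0 cone_neq0.
  apply/negP; rewrite addr_eq0 => /eqP xE; apply: indep; exists (- t^-1).
  by rewrite xE scalerN scaleNr opprK scalerA mulVf ?scale1r.
have y_tx t : (y : IC) + t *: (x : IC) != 0 :> IC.
  apply/negP; rewrite addr_eq0 => /eqP yE; apply: indep; exists (- t).
  by rewrite yE scaleNr.
have [g eg gP] := cone_additive_entire hf x_ty xy.
have yx : dot y x = 0 by rewrite dotC.
have [h eh hP] := cone_additive_entire hf y_tx yx.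
have gh t : t != 0 -> g t = t * h t^-1.
  move=> t0.
  have Q1 : quad ((x : IC) + t *: (y : IC)) = 0.
    by rewrite quadD quadZ !cone_null dotZr xy; ring.
  have Q2 : quad ((y : IC) + t^-1 *: (x : IC)) = 0.
    by rewrite quadD quadZ !cone_null dotZr yx; ring.
  rewrite (gP t (MkCone (x_ty t) Q1)) // (hP t^-1 (MkCone (y_tx _) Q2)) //.
  by apply: hom; rewrite /= scalerDr scalerA divff // scale1r addrC.
have := section_line_affine eg eh gh 1.
rewrite (gP 1 z) ?scale1r // (gP 0 x) ?scale0r ?addr0 //.
by rewrite (hP 0 y) ?scale0r ?addr0 // mul1r.
Qed.

(** The Borel-Weil theorem for O(1) over the projective quadric. Extended by 0
    at the origin, f is additive on null vectors by [cone_additive], so that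
    [null_additive_linear] applies. *)
Theorem homogeneous_holomorphic_linear (f : cone -> C) :
  homogeneous f -> holomorphic_along (@cone_val R) f ->
  exists w, forall x : cone, f x = dot w x.
Proof.
move=> hom hf.
pose F (x : IC) : C := if pselect (x != 0 /\ quad x = 0) is left H
  then f (MkCone H.1 H.2) else 0.
have Ff (x : cone) : F x = f x.
  rewrite /F; case: pselect => [H|[]]; first by congr f; exact: cone_eq.
  by split; [exact: cone_neq0 | exact: cone_null].
have F0 : F 0 = 0 by rewrite /F; case: pselect => // H; case/eqP: (H.1).
have coneP x : quad x = 0 -> x = 0 \/ exists2 c : cone, x = c & F x = f c.
  move=> Q; have [|x0] := eqVneq x 0; [by left | right].
  by exists (MkCone x0 Q) => //; exact: (Ff (MkCone x0 Q)).
have [||w wP] := @null_additive_linear C F.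
- move=> k x Q; have [->|[c xE ->]] := coneP x Q; first by rewrite scaler0 F0 mulr0.
  have [->|k0] := eqVneq k 0; first by rewrite scale0r F0 mul0r.
  have Qk : quad (k *: x) = 0 by rewrite quadZ Q mulr0.
  have [/eqP|[c' kE ->]] := coneP _ Qk.
    by rewrite scaler_eq0 (negbTE k0) xE (negbTE (cone_neq0 c)).
  by apply: hom; rewrite -kE xE.
- move=> x y Qx Qy Qxy.
  have [->|[c cE Fx]] := coneP x Qx; first by rewrite F0 !add0r.
  have [->|[d dE Fy]] := coneP y Qy; first by rewrite F0 !addr0.
  rewrite Fx Fy; have [/eqP|[e E ->]] := coneP _ Qxy; last first.
    by apply: cone_additive => //; rewrite -E cE dE.
  rewrite cE dE.
  rewrite addr_eq0 => /eqP cd; rewrite cd addNr F0 [f c](_ : f c = -1 * f d).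
    by rewrite mulN1r addNr.
  by apply: hom; rewrite cd scaleN1r.
by exists w => x; rewrite -Ff wP ?cone_null.
Qed.

End ConeFunctions.

(** * Global sections of the line bundles *)
Section Sections.
Variable R : realType.
Local Notation C := R[i].
Local Notation IC := (imoct C).
Local Notation cone := (cone R).

Lemma span_cone_scale (k : C) (x y : cone) : y = k *: (x : IC) :> IC ->
  span_cone y = span_cone x.
Proof.
move=> yE; apply: PC_eq; rewrite /= yE.
have k0 : k != 0.
  by apply: contra (cone_neq0 y) => /eqP k0; rewrite yE k0 scale0r.
apply/vspaceP => v; apply/vlineP/vlineP => -[l ->]; rewrite ?scalerA; first by exists (l * k).
by exists (l / k); rewrite scalerA divfK.
Qed.

Lemma PC_span_cone (p : PC R) : exists x, p = span_cone x.
Proof.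
have p0 : (p : {vspace IC}) != 0%VS by rewrite -dimv_eq0 PC_dim.
have x0 : vpick p != 0 by rewrite vpick0.
have xp := memv_pick p.
exists (MkCone x0 (PC_null xp)); apply: PC_eq => /=.
by apply/eqP; rewrite eq_sym eqEdim -memvE xp PC_dim dim_vline x0.
Qed.

Lemma L_total_homogeneous (s : Gamma_L R) : homogeneous (L_total s).
Proof.
move=> k x y yE; rewrite /L_total (span_cone_scale yE) yE linearZ /=.
by rewrite linearZ.
Qed.

(** [LL_total] with the two lines as separate arguments: this allows rewriting
    with an equation between lines inside the dependent types. *)
Let LL_value (s : all_sections (@LL_fiber R)) (p q : PC R) (u v : IC) : C :=
  s (p, q) (vsproj p u) (vsproj q v).

Lemma LL_total_homogeneousl (s : Gamma_LL R) y :
  homogeneous (fun x => LL_total s (x, y)).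
Proof.
move=> k x x' xE.
rewrite -[LHS]/(LL_value s (span_cone x') (span_cone y) x' y).
rewrite -[LL_total s _]/(LL_value s (span_cone x) (span_cone y) x y).
by rewrite /LL_value (span_cone_scale xE) xE !linearZ /= scale_lfunE.
Qed.

Lemma LL_total_homogeneousr (s : Gamma_LL R) x :
  homogeneous (fun y => LL_total s (x, y)).
Proof.
move=> k y y' yE.
rewrite -[LHS]/(LL_value s (span_cone x) (span_cone y') x y').
rewrite -[LL_total s _]/(LL_value s (span_cone x) (span_cone y) x y).
by rewrite /LL_value (span_cone_scale yE) yE !linearZ.
Qed.

Lemma L_total_inj (s s' : Gamma_L R) : L_total s =1 L_total s' -> s = s'.
Proof.
move=> ss; apply: val_inj; apply: functional_extensionality_dep => p /=.
have [x ->] := PC_span_cone p; apply/lfunP => u.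
have /vlineP[k uE] := subvsP u.
have -> : u = k *: vsproj (span_cone x) x.
  by apply: subvs_inj; rewrite linearZ /= vsprojK ?memv_line.
by rewrite !linearZ; congr (_ *: _); exact: ss.
Qed.

Lemma LL_total_inj (s s' : Gamma_LL R) : LL_total s =1 LL_total s' -> s = s'.
Proof.
move=> ss; apply: val_inj; apply: functional_extensionality_dep => -[p q] /=.
have [x ->] := PC_span_cone p; have [y ->] := PC_span_cone q.
apply/lfunP => u; apply/lfunP => v.
have /vlineP[k uE] := subvsP u; have /vlineP[l vE] := subvsP v.
have -> : u = k *: vsproj (span_cone x) x.
  by apply: subvs_inj; rewrite linearZ /= vsprojK ?memv_line.
have -> : v = l *: vsproj (span_cone y) y.
  by apply: subvs_inj; rewrite linearZ /= vsprojK ?memv_line.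
rewrite !linearZ /= !scale_lfunE; congr (_ *: _); congr (_ *: _).
exact: (ss (x, y)).
Qed.

Lemma L_section_surj (s : Gamma_L R) : exists w, s = L_section w.
Proof.
have /asboolP hs := Gamma_L_holo s.
have [w wP] := homogeneous_holomorphic_linear (@L_total_homogeneous s) hs.
by exists w; apply: L_total_inj => x; rewrite wP L_total_family.
Qed.

Lemma LL_total_linearl (s : Gamma_LL R) y :
  exists w, forall x, LL_total s (x, y) = dot w x.
Proof.
have /asboolP hs := Gamma_LL_holo s.
apply: homogeneous_holomorphic_linear (@LL_total_homogeneousl s y) _.
exact: holomorphic_along_slicel hs.
Qed.

Lemma LL_total_linearr (s : Gamma_LL R) x :
  exists w, forall y, LL_total s (x, y) = dot w y.
Proof.
have /asboolP hs := Gamma_LL_holo s.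
apply: homogeneous_holomorphic_linear (@LL_total_homogeneousr s x) _.
exact: holomorphic_along_slicer hs.
Qed.

Lemma dotDl k (x y z : IC) : dot (k *: x + y) z = k * dot x z + dot y z.
Proof. by rewrite !(dotC _ z) dot_linear. Qed.

(** Identities between multilinear expressions need only be checked on the
    cone, because the null vectors span. *)
Lemma cone_ind (P : IC -> Prop) : (forall x : cone, P x) ->
  (forall k x y, P x -> P y -> P (k *: x + y)) -> forall x, P x.
Proof.
move=> Pc PD; apply: null_span => // x Q.
have Pc' y (y0 : y != 0) (Qy : quad y = 0) : P y := Pc (MkCone y0 Qy).
have [->|x0] := eqVneq x 0; last exact: Pc'.
have e0 : split_vec 1 0 0 0 0 0 0 != 0 :> IC.
  by apply/eqP => /rowP/(_ 0); rewrite !mxE /= addr0; apply/eqP/oner_neq0.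
have Pe : P (split_vec 1 0 0 0 0 0 0).
  by apply: Pc' e0 _; rewrite quad_split_vec; ring.
by have := PD (-1) _ _ Pe Pe; rewrite scaleN1r addNr.
Qed.

End Sections.

(** * Monomial elements of the group *)
Section UnitVectors.
Variable K : numFieldType.
Local Notation V := (imoct K).
Implicit Types x y w : V.

(** The index is a natural number, so that permutations of the basis are
    computable tables. *)
Definition unit_vec (n : nat) : V := \row_(j < 7) (j == n :> nat)%:R.

Lemma row_unit_vec x : x = x 0 0 *: unit_vec 0 + (x 0 1 *: unit_vec 1 +
  (x 0 2 *: unit_vec 2 + (x 0 3 *: unit_vec 3 + (x 0 4 *: unit_vec 4 +
  (x 0 5 *: unit_vec 5 + (x 0 6 *: unit_vec 6 + 0)))))).
Proof.
apply/rowP; case=> [[|[|[|[|[|[|[|//]]]]]]] Hi]; do ![rewrite mxE /=];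
  rewrite ?(mulr0, mulr1, addr0, add0r); congr (x _ _); exact: val_inj.
Qed.

Lemma dot_unit_vec x : [/\ dot (unit_vec 0) x = x 0 0, dot (unit_vec 1) x = x 0 1
  & dot (unit_vec 2) x = x 0 2] /\ [/\ dot (unit_vec 3) x = - x 0 3,
  dot (unit_vec 4) x = - x 0 4, dot (unit_vec 5) x = - x 0 5 &
  dot (unit_vec 6) x = - x 0 6].
Proof. by split; split; rewrite dotE !mxE /=; ring. Qed.

Lemma dot_nondegenerate x y : (forall w, dot x w = dot y w) -> x = y.
Proof.
move=> xy; have {}xy w : dot w x = dot w y by rewrite !(dotC w).
have [[x0 x1 x2] [x3 x4 x5 x6]] := dot_unit_vec x.
have [[y0 y1 y2] [y3 y4 y5 y6]] := dot_unit_vec y.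
rewrite (row_unit_vec x) (row_unit_vec y) -x0 -x1 -x2 -y0 -y1 -y2.
by rewrite -[x 0 3]opprK -x3 -[x 0 4]opprK -x4 -[x 0 5]opprK -x5 -[x 0 6]opprK -x6
  -[y 0 3]opprK -y3 -[y 0 4]opprK -y4 -[y 0 5]opprK -y5 -[y 0 6]opprK -y6 !xy.
Qed.

Lemma unit_vec_ind (P : V -> Prop) : P 0 ->
  (forall k x y, P x -> P y -> P (k *: x + y)) ->
  (forall n, (n < 7)%N -> P (unit_vec n)) -> forall x, P x.
Proof.
move=> P0 PD Pe x; rewrite (row_unit_vec x).
by do 7!(apply: (PD); first exact: Pe).
Qed.

End UnitVectors.

Section MonomialElements.
Variable R : realType.
Local Notation C := R[i].
Local Notation IC := (imoct C).
Local Notation e := (@unit_vec C).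
Implicit Types (x y : IC).

(** Preserving the nondegenerate form dot makes l injective, which is the
    invertibility asked of an element of the group. *)
Lemma G2_of_isometry (l : IC -> IC) : linear l ->
  (forall x y, dot (l x) (l y) = dot x y) ->
  (forall x y, l (cross x y) = cross (l x) (l y)) ->
  exists g : G2C R, forall x, g x = l x.
Proof.
move=> linl dotl crossl.
pose L : {linear IC -> IC} := HB.pack l (GRing.isLinear.Build _ _ _ _ l linl).
have LE x : linfun L x = l x by rewrite lfunE.
have inj : lker (linfun L) == 0%VS.
  apply/lker0P => x y; rewrite !LE => xy; apply: dot_nondegenerate => w.
  by rewrite -!(dotl _ w) xy.
have crossL x y : linfun L (cross x y) = cross (linfun L x) (linfun L y).
  by rewrite !LE crossl.
by exists (MkG2C inj crossL).
Qed.

(** Label e_n by the binary digits of n + 1, a nonzero vector of F_2 ^ 3. Then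
    e_i x e_j is, up to sign, the e_k with label the sum of those of e_i and
    e_j, and vanishes for i = j: the lines of the Fano plane are the triples of
    labels with sum 0. The map below induces the linear map of F_2 ^ 3 that
    sends 1 to 2, 2 to 3 and 4 to 4. *)
Definition rotation x : IC :=
  \row_(i < 7) [:: x 0 2; x 0 0; x 0 1; x 0 3; x 0 6; x 0 4; x 0 5]`_i.

Lemma rotation_G2 : exists g : G2C R, forall x, g x = rotation x.
Proof.
apply: G2_of_isometry => [k x y|x y|x y].
- apply/rowP; by case=> [[|[|[|[|[|[|[|//]]]]]]] ?]; do ![rewrite mxE /=].
- by rewrite !dotE !mxE /=; ring.
- rewrite !crossE; apply/rowP.
  by case=> [[|[|[|[|[|[|[|//]]]]]]] ?]; do ![rewrite mxE /=]; ring.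
Qed.

(** Exchanging the first and the last binary digit of the labels exchanges e_0
    with e_3 and e_2 with e_5. These have opposite norms, whence the factors
    'i. *)
Definition swap x : IC :=
  \row_(i < 7) [:: 'i * x 0 3; x 0 1; 'i * x 0 5; 'i * x 0 0; x 0 4; 'i * x 0 2; x 0 6]`_i.

Lemma swap_G2 : exists g : G2C R, forall x, g x = swap x.
Proof.
have i2 : 'i * 'i = -1 :> C by rewrite -expr2 sqrCi.
apply: G2_of_isometry => [k x y|x y|x y].
- apply/rowP; by case=> [[|[|[|[|[|[|[|//]]]]]]] ?]; do ![rewrite mxE /=]; ring.
- by rewrite !dotE !mxE /=; ring: i2.
- rewrite !crossE; apply/rowP.
  by case=> [[|[|[|[|[|[|[|//]]]]]]] ?]; do ![rewrite mxE /=]; ring: i2.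
Qed.

Definition bit (b n : nat) : bool := odd (n %/ 2 ^ b).

(** Signs given by a character of F_2 ^ 3 multiply along the lines of the Fano
    plane. *)
Definition sign_change b x : IC := \row_(i < 7) ((-1) ^+ bit b i.+1 * x 0 i).

Lemma sign_change_G2 b : (b < 3)%N -> exists g : G2C R, forall x, g x = sign_change b x.
Proof.
move=> b3; apply: G2_of_isometry => [k x y|x y|x y].
- by apply/rowP => i; rewrite !mxE mulrDr mulrCA.
- by rewrite !dotE !mxE; case: b b3 => [|[|[|//]]] _ /=; ring.
- rewrite !crossE; apply/rowP; case: b b3 => [|[|[|//]]] _.
  + by case=> [[|[|[|[|[|[|[|//]]]]]]] ?]; do ![rewrite mxE /=]; ring.
  + by case=> [[|[|[|[|[|[|[|//]]]]]]] ?]; do ![rewrite mxE /=]; ring.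
  + by case=> [[|[|[|[|[|[|[|//]]]]]]] ?]; do ![rewrite mxE /=]; ring.
Qed.

End MonomialElements.

(** * Invariant trilinear forms *)
Section FanoPlane.

Definition rotation_perm (n : nat) := nth 0%N [:: 1; 2; 0; 3; 5; 6; 4]%N n.
Definition swap_perm (n : nat) := nth 0%N [:: 3; 1; 5; 0; 4; 2; 6]%N n.

Definition map3 (p : nat -> nat) (t : nat * nat * nat) :=
  (p t.1.1, p t.1.2, p t.2).

Definition fano_step (S : seq (nat * nat * nat)) :=
  undup (S ++ map (map3 rotation_perm) S ++ map (map3 swap_perm) S).

(** The labels of i, j and k have nonzero sum: some digit of the sum is 1. *)
Definition odd_triple i j k :=
  has (fun b => bit b i.+1 (+) bit b j.+1 (+) bit b k.+1) (iota 0 3).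

(** The two permutations act on the ordered lines of the Fano plane as a
    transitive group, namely GL_3 (F_2): nine steps reach all the 42 ordered
    lines. *)
Lemma fano_triples i j k : (i < 7)%N -> (j < 7)%N -> (k < 7)%N ->
  odd_triple i j k || ((i, j, k) \in iter 9 fano_step [:: (2, 0, 1)%N]).
Proof.
have : all (fun i => all (fun j => all (fun k => odd_triple i j k ||
    ((i, j, k) \in iter 9 fano_step [:: (2, 0, 1)%N])) (iota 0 7)) (iota 0 7)) (iota 0 7).
  by vm_compute.
move=> /allP H i7 j7 k7.
have /H/allP {}H : i \in iota 0 7 by rewrite mem_iota.
have /H/allP {}H : j \in iota 0 7 by rewrite mem_iota.
by apply: H; rewrite mem_iota.
Qed.

(** All ordered lines are reached from (2, 0, 1) by the symmetries, and the
    other triples are odd ([fano_triples]). *)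
Lemma fano_ind (P : nat -> nat -> nat -> Prop) :
  P 2%N 0%N 1%N ->
  (forall i j k, (i < 7)%N -> (j < 7)%N -> (k < 7)%N -> P i j k ->
     P (rotation_perm i) (rotation_perm j) (rotation_perm k)) ->
  (forall i j k, (i < 7)%N -> (j < 7)%N -> (k < 7)%N -> P i j k ->
     P (swap_perm i) (swap_perm j) (swap_perm k)) ->
  (forall i j k, (i < 7)%N -> (j < 7)%N -> (k < 7)%N -> odd_triple i j k -> P i j k) ->
  forall i j k, (i < 7)%N -> (j < 7)%N -> (k < 7)%N -> P i j k.
Proof.
move=> P0 Pr Ps Po i j k i7 j7 k7.
have r7 n : (n < 7)%N -> (rotation_perm n < 7)%N by case: n => [|[|[|[|[|[|[|]]]]]]].
have s7 n : (n < 7)%N -> (swap_perm n < 7)%N by case: n => [|[|[|[|[|[|[|]]]]]]].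
have step n t : t \in iter n fano_step [:: (2, 0, 1)%N] ->
    [/\ (t.1.1 < 7)%N, (t.1.2 < 7)%N, (t.2 < 7)%N & P t.1.1 t.1.2 t.2].
  elim: n t => [|n IH] t; first by rewrite inE => /eqP ->.
  rewrite iterS mem_undup !mem_cat => /or3P[/IH//|/mapP|/mapP] [u /IH[u1 u2 u3 Pu] ->] /=.
    by split; rewrite ?r7 //; exact: Pr.
  by split; rewrite ?s7 //; exact: Ps.
by have /orP[ot|/step[]//] := fano_triples i7 j7 k7; exact: Po.
Qed.

End FanoPlane.

Section InvariantForms.
Variable R : realType.
Local Notation C := R[i].
Local Notation IC := (imoct C).
Local Notation e := (@unit_vec C).

Definition trilinear_form (B : IC -> IC -> IC -> C) :=
  [/\ forall k w w' x y, B (k *: w + w') x y = k * B w x y + B w' x y,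
      forall k w x x' y, B w (k *: x + x') y = k * B w x y + B w x' y &
      forall k w x y y', B w x (k *: y + y') = k * B w x y + B w x y'].

Definition G2_invariant (B : IC -> IC -> IC -> C) :=
  forall (g : G2C R) w x y, B (g w) (g x) (g y) = B w x y.

Section Trilinear.
Variable B : IC -> IC -> IC -> C.
Hypothesis lB : trilinear_form B.

Lemma trilinear0 : [/\ forall x y, B 0 x y = 0, forall w y, B w 0 y = 0 &
  forall w x, B w x 0 = 0].
Proof.
have [l1 l2 l3] := lB; split=> u v.
- by have := l1 (-1) u u u v; rewrite scaleN1r addNr mulN1r addNr.
- by have := l2 (-1) u u u v; rewrite scaleN1r addNr mulN1r addNr.
- by have := l3 (-1) u v u u; rewrite scaleN1r addNr mulN1r addNr.
Qed.

Lemma trilinearZ a b c w x y :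
  B (a *: w) (b *: x) (c *: y) = a * b * c * B w x y.
Proof.
have [l1 l2 l3] := lB; have [z1 z2 z3] := trilinear0.
have Z1 k u v t : B (k *: u) v t = k * B u v t by rewrite -[k *: u]addr0 l1 z1 addr0.
have Z2 k u v t : B u (k *: v) t = k * B u v t by rewrite -[k *: v]addr0 l2 z2 addr0.
have Z3 k u v t : B u v (k *: t) = k * B u v t by rewrite -[k *: t]addr0 l3 z3 addr0.
by rewrite Z1 Z2 Z3 !mulrA.
Qed.

End Trilinear.

Lemma trilinear_eq B B' : trilinear_form B -> trilinear_form B' ->
  (forall i j k, (i < 7)%N -> (j < 7)%N -> (k < 7)%N ->
    B (e i) (e j) (e k) = B' (e i) (e j) (e k)) ->
  forall w x y, B w x y = B' w x y.
Proof.
move=> lB lB' H w x y.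
have [l1 l2 l3] := lB; have [z1 z2 z3] := trilinear0 lB.
have [l1' l2' l3'] := lB'; have [z1' z2' z3'] := trilinear0 lB'.
move: w; apply: unit_vec_ind => [|k w w' E E'|i i7]; first by rewrite z1 z1'.
  by rewrite l1 l1' E E'.
move: x; apply: unit_vec_ind => [|k x x' E E'|j j7]; first by rewrite z2 z2'.
  by rewrite l2 l2' E E'.
move: y; apply: unit_vec_ind => [|k y y' E E'|k k7]; first by rewrite z3 z3'.
  by rewrite l3 l3' E E'.
exact: H.
Qed.

Definition cross_form (w x y : IC) : C := dot w (cross x y).

Lemma cross_form_trilinear : trilinear_form cross_form.
Proof.
rewrite /cross_form; split=> k a b c d.
- by rewrite !(dotC _ (cross _ _)) dot_linear.
- by rewrite -dot_linear; congr (dot _ _); rewrite !(cross_anti _ d) cross_linear scalerN opprD.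
- by rewrite cross_linear dot_linear.
Qed.

Lemma dot_G2 (g : G2C R) x y : dot (g x) (g y) = dot x y.
Proof. by rewrite /dot -linearD !G2_quad. Qed.

Lemma cross_form_G2 : G2_invariant cross_form.
Proof. by move=> g w x y; rewrite /cross_form -G2_cross dot_G2. Qed.

(** The forms B and [cross_form] are both invariant. Off the lines of the Fano
    plane, a sign change multiplies the value of either form by -1, so both
    vanish. A permutation of the basis multiplies the values of both by the
    same nonzero factor, so the proportionality of B and [cross_form] spreads
    from the ordered line (2, 0, 1), where [cross_form] is 1, to all of
    them. *)
Theorem G2_invariant_trilinear_form B : trilinear_form B -> G2_invariant B ->
  exists c, forall w x y, B w x y = c * cross_form w x y.
Proof.
move=> lB gB; have lX := cross_form_trilinear; have gX := cross_form_G2.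
exists (B (e 2) (e 0) (e 1)).
have lcX c : trilinear_form (fun w x y => c * cross_form w x y).
  have [l1 l2 l3] := lX.
  by split=> *; rewrite ?l1 ?l2 ?l3 mulrDr mulrCA.
apply: trilinear_eq => //; set c := B _ _ _.
have moved (l : IC -> IC) (p : nat -> nat) : (exists g : G2C R, forall x, g x = l x) ->
    (forall n, (n < 7)%N -> exists2 d : C, d != 0 & l (e n) = d *: e (p n)) ->
    forall i j k, (i < 7)%N -> (j < 7)%N -> (k < 7)%N ->
    B (e i) (e j) (e k) = c * cross_form (e i) (e j) (e k) ->
    B (e (p i)) (e (p j)) (e (p k)) = c * cross_form (e (p i)) (e (p j)) (e (p k)).
  move=> [g gE] lp i j k /lp[d1 d10 E1] /lp[d2 d20 E2] /lp[d3 d30 E3].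
  rewrite -(gB g) -(gX g) !gE E1 E2 E3 (trilinearZ lB) (trilinearZ lX) mulrCA.
  by apply: mulfI; rewrite !mulf_neq0.
apply: fano_ind.
- suff -> : cross_form (e 2) (e 0) (e 1) = 1 by rewrite mulr1.
  by rewrite /cross_form dotE !crossE; do ![rewrite mxE /=]; ring.
- apply: (moved _ rotation_perm (rotation_G2 R)).
  case=> [|[|[|[|[|[|[|//]]]]]]] _; exists 1; rewrite ?oner_neq0 //;
  apply/rowP; case=> [[|[|[|[|[|[|[|//]]]]]]] ?]; do ![rewrite mxE /=]; by ring.
- apply: (moved _ swap_perm (swap_G2 R)).
  have i0 : 'i != 0 :> C by exact: neq0Ci.
  case=> [|[|[|[|[|[|[|//]]]]]]] _;
    [exists 'i|exists 1|exists 'i|exists 'i|exists 1|exists 'i|exists 1];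
    rewrite ?oner_neq0 //;
  apply/rowP; case=> [[|[|[|[|[|[|[|//]]]]]]] ?]; do ![rewrite mxE /=]; by ring.
- move=> i j k i7 j7 k7 /hasP[b b3 ob].
  have [|g gE] := @sign_change_G2 R b; first by move: b3; rewrite mem_iota.
  have sE n : g (e n) = (-1) ^+ bit b n.+1 *: e n.
    rewrite gE; apply/rowP => t; rewrite !mxE.
    by have [->|_] := eqVneq (t : nat) n; rewrite ?mulr0.
  have vanish F : trilinear_form F -> G2_invariant F -> F (e i) (e j) (e k) = 0.
    move=> lF gF; have := gF g (e i) (e j) (e k).
    rewrite !sE (trilinearZ lF) -!signr_addb ob mulN1r => /eqP.
    by rewrite eqNr => /eqP.
  by rewrite !vanish ?mulr0.
Qed.

End InvariantForms.

(** * Equivariant maps between the spaces of sections *)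
Section EquivariantMaps.
Variable R : realType.
Local Notation C := R[i].
Local Notation IC := (imoct C).
Local Notation cone := (cone R).
Local Notation E i := (delta_mx 0 i : IC).

Lemma dot_sumr (w x : IC) : dot w x = \sum_i x 0 i * dot w (E i).
Proof.
rewrite {1}(row_sum_delta x) linear_sum; apply: eq_bigr => i _.
by rewrite linearZ.
Qed.

Lemma coord_dot : exists n : 'I_(3 + 4) -> C, forall i (x : IC), x 0 i = n i * dot (E i) x.
Proof.
exists (fun i => if (i < 3)%N then 1 else -1) => i x.
case: i => [[|[|[|[|[|[|[|//]]]]]]] Hi]; rewrite dotE !mxE /=
  ?(mul0r, mul1r, mulN1r, addr0, add0r, subr0, sub0r, oppr0, opprK);
  congr (x _ _); exact: val_inj.
Qed.

(** For fixed y, a section is a linear form in x, so it is determined by its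
    values at the standard basis; these are linear in y, which is seen by
    writing a basis vector in terms of null vectors x. *)
Lemma LL_section_surj (s : Gamma_LL R) : exists T, s = LL_section T.
Proof.
have [n nP] := coord_dot.
have coord (i : 'I_(3 + 4)) : exists v, forall y w,
    (forall x, LL_total s (x, y) = dot w x) -> dot w (E i) = dot v y.
  move: (E i); apply: cone_ind => [x|k u u' [v vP] [v' v'P]].
    have [v vP] := LL_total_linearr s x.
    by exists v => y w wP; rewrite -wP.
  exists (k *: v + v') => y w wP.
  by rewrite dotDl dot_linear (vP y) ?(v'P y).
have [v vP] := choice coord.
exists (\matrix_(i, j) (n i * v i 0 j)).
apply: LL_total_inj => -[x y]; have [w wP] := LL_total_linearl s y.
rewrite wP LL_total_family /= dot_sumr /tens_eval; apply: eq_bigr => i _.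
rewrite (vP i y) // dotC dot_sumr mulr_sumr; apply: eq_bigr => j _.
by rewrite mxE (nP i x) (dotC y); ring.
Qed.

Variable delta : {linear Gamma_L R -> Gamma_LL R}.
Hypothesis delta_equivariant : forall (g : G2C R) (s : Gamma_L R),
      delta (L_act g s) = LL_act g (delta s).

Definition delta_form (w x y : IC) : C := tens_eval (delta_imoct delta w) x y.

Lemma LL_section_delta w : LL_section (delta_imoct delta w) = delta (L_section w).
Proof.
rewrite /delta_imoct /LL_tensor.
have [T TE] := LL_section_surj (delta (L_section w)).
exact: (@xgetPex _ 0 [set T | LL_section T = delta (L_section w)] (ex_intro _ T (esym TE))).
Qed.

Lemma delta_formE w (x y : cone) :
  delta_form w x y = LL_total (delta (L_section w)) (x, y).
Proof. by rewrite -LL_section_delta LL_total_family. Qed.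

Lemma tens_eval_linearl T k (x x' y : IC) :
  tens_eval T (k *: x + x') y = k * tens_eval T x y + tens_eval T x' y.
Proof. exact: tens_evalDr. Qed.

Lemma tens_eval_linearr T k (x y y' : IC) :
  tens_eval T x (k *: y + y') = k * tens_eval T x y + tens_eval T x y'.
Proof. exact: tens_evalDl. Qed.

Lemma L_section_linear k (w w' : IC) :
  L_section (k *: w + w') = k *: L_section w + L_section w'.
Proof.
apply: L_total_inj => x; rewrite L_total_family.
have -> : L_total (k *: L_section w + L_section w') x =
  k * L_total (L_section w) x + L_total (L_section w') x.
  by rewrite /L_total add_lfunE scale_lfunE.
by rewrite !L_total_family dotDl.
Qed.

Lemma L_act_section (g : G2C R) w : L_act g (L_section w) = L_section (g w).
Proof.
apply: L_total_inj => x; rewrite L_total_pull !L_total_family /=.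
by rewrite -(dot_G2 g) (lker0_lfunVK (G2_inj g)).
Qed.

Lemma delta_form_trilinear : trilinear_form delta_form.
Proof.
split=> [k w w' x y|k w x x' y|k w x y y'].
- move: x; apply: cone_ind => [x|l x x' H H'].
    move: y; apply: cone_ind => [y|l y y' H H'].
      by rewrite !delta_formE L_section_linear linearP /LL_total !(add_lfunE, scale_lfunE).
    by move: H H'; rewrite /delta_form !tens_eval_linearr => -> ->;
      rewrite !mulrDr addrACA (mulrCA l).
  by move: H H'; rewrite /delta_form !tens_eval_linearl => -> ->;
      rewrite !mulrDr addrACA (mulrCA l).
- exact: tens_eval_linearl.
- exact: tens_eval_linearr.
Qed.

Lemma delta_form_G2 : G2_invariant delta_form.
Proof.
move=> g w x y; rewrite /delta_form.
move: x; apply: cone_ind => [x|l x x' H H']; last by rewrite linearP !tens_eval_linearl H H'.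
move: y; apply: cone_ind => [y|l y y' H H']; last by rewrite linearP !tens_eval_linearr H H'.
rewrite -!/(delta_form _ _ _) (delta_formE _ (G2_cone g x) (G2_cone g y)) delta_formE.
rewrite -L_act_section delta_equivariant LL_total_pull /=; congr (LL_total _ (_, _)).
  by apply: cone_eq; rewrite /= (lker0_lfunK (G2_inj g)).
by apply: cone_eq; rewrite /= (lker0_lfunK (G2_inj g)).
Qed.

(** The defining property of the adjoint has a solution, and only one because
    dot is nondegenerate. *)
Lemma adjoint_delta c : (forall w x y, delta_form w x y = c * cross_form w x y) ->
  forall T, adjoint (delta_imoct delta) T = c *: tens_cross T.
Proof.
move=> H T.
have vP : forall w, dot (c *: tens_cross T) w = tens_dot (delta_imoct delta w) T.
  move=> w; rewrite dotC dotZr /tens_cross linear_sum /tens_dot mulr_sumr; apply: eq_bigr => i _.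
  rewrite linear_sum mulr_sumr; apply: eq_bigr => j _.
  by rewrite /= dotZr -/(delta_form _ _ _) H /cross_form mulrCA.
apply: dot_nondegenerate => w; rewrite vP.
exact: (@xgetPex _ 0 [set v | forall w, dot v w = tens_dot (delta_imoct delta w) T]
  (ex_intro _ _ vP)).
Qed.

End EquivariantMaps.

Theorem theorem30 (R : realType)
    (delta : {linear Gamma_L R -> Gamma_LL R})
    (delta_neq0 : exists s : Gamma_L R, delta s != 0)
    (delta_equivariant : forall (g : G2C R) (s : Gamma_L R),
      delta (L_act g s) = LL_act g (delta s)) :
  exists c : complex R, c != 0 /\
    forall T : imoct2 (complex R),
      adjoint (delta_imoct delta) T = c *: tens_cross T.
Proof.
have [c cP] := G2_invariant_trilinear_form (delta_form_trilinear delta)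
  (delta_form_G2 delta_equivariant).
exists c; split; last exact: adjoint_delta.
apply/eqP => c0; have [s /eqP[]] := delta_neq0.
have [w ->] := L_section_surj s.
apply: LL_total_inj => -[x y].
by rewrite -delta_formE cP c0 mul0r /LL_total !lfunE.
Qed.
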